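(* Let $N\ge0$, $\mathbf a_N=(a(0),\dots,a(N))\in\mathbb C^{N+1}$, $P_2>0$, $D_g^0=\{g:\frac1{2\pi}\int_{-\pi}^\pi g(\lambda)d\lambda\le P_2\}$. Let the spectral density $f(\lambda)$ be known and fixed, and let $g_0\in D_g^0$ be such that $(f(\lambda)+g_0(\lambda))^{-1}$ is integrable. Put $C_N^0(e^{i\lambda})=\sum_{j=0}^N((\mathbf B_N^0)^{-1}\mathbf R_N^0\mathbf a_N)_je^{ij\lambda}$ and let $$h_g(f,g_0)=\frac{|A_N(e^{i\lambda})f(\lambda)-C_N^0(e^{i\lambda})|^2}{(f(\lambda)+g_0(\lambda))^2}$$ be bounded. Suppose that for some constant $\alpha_2>0$ $$g_0(\lambda)=\max\left\{0,\ \alpha_2^{-1}\left|A_N(e^{i\lambda})f(\lambda)-C_N^0(e^{i\lambda})\right|-f(\lambda)\right\}$$ and that $(f,g_0)$ determines a solution to the optimization problem $$\max_{g\in D_g^0}\left(\langle\mathbf R_N\mathbf a_N,\mathbf B_N^{-1}\mathbf R_N\mathbf a_N\rangle+\langle\mathbf Q_N\mathbf a_N,\mathbf a_N\rangle\right)=\langle\mathbf R_N^0\mathbf a_N,(\mathbf B_N^0)^{-1}\mathbf R_N^0\mathbf a_N\rangle+\langle\mathbf Q_N^0\mathbf a_N,\mathbf a_N\rangle .$$ Then $g_0$ is the least favourable spectral density in $D_g^0$ for the optimal linear estimate of $A_N\xi=\sum_{j=0}^Na(j)\xi(j)$ from observations of $\xi(j)+\eta(j)$, $j\in\mathbb Z\setminus\{0,\dots,N\}$,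 and $$h^0(e^{i\lambda})=\frac{A_N(e^{i\lambda})f(\lambda)-C_N^0(e^{i\lambda})}{f(\lambda)+g_0(\lambda)}$$ is the minimax-robust spectral characteristic of the optimal linear estimate of $A_N\xi$.
   Context: $\xi,\eta$ are zero mean uncorrelated wide sense stationary sequences with spectral densities $f,g$ ($E\xi(j+k)\overline{\xi(j)}=\frac1{2\pi}\int e^{ik\lambda}f\,d\lambda$, etc.). $A_N(e^{i\lambda})=\sum_{j=0}^Na(j)e^{ij\lambda}$, $\langle x,y\rangle=\sum_{k=0}^Nx_k\overline{y_k}$. $\mathbf B_N,\mathbf R_N,\mathbf Q_N$ are the $(N+1)\times(N+1)$ matrices with entries $\frac1{2\pi}\int_{-\pi}^\pi e^{-i(j-k)\lambda}\psi(\lambda)d\lambda$, $j,k=0,\dots,N$, with $\psi=\frac1{f+g}$, $\frac f{f+g}$, $\frac{fg}{f+g}$ respectively; superscript $0$ refers to $(f,g_0)$. Wherever $\mathbf B_N^{-1}$ is used, $(f,g)$ is understood to satisfy $\int(f+g)^{-1}d\lambda<\infty$. $L_2^N(f+g)$ is the closed span of $\{e^{ij\lambda}:j\in\mathbb Z\setminus\{0,\dots,N\}\}$ in $L_2(f+g)$; for $h\in L_2^N(f+g)$, $\Delta(h;f,g)=\frac1{2\pi}\int|A_N-h|^2f\,d\lambda+\frac1{2\pi}\int|h|^2g\,d\lambda$, and $h(f,g)$ is its minimizer. With $f$ fixed, $g_0$ is least favourable in a class $D_g$ if $\Delta(h(f,g_0);f,g_0)=\max_{g\in D_g}\Delta(h(f,g);f,g)$;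 $h^0$ is minimax-robust if $h^0\in H_D=\bigcap_{g\in D_g}L_2^N(f+g)$ and $\min_{h\in H_D}\max_{g\in D_g}\Delta(h;f,g)=\sup_{g\in D_g}\Delta(h^0;f,g)$. *)

(* Defs.v *)
From mathcomp Require Import all_boot all_order all_algebra.
From mathcomp Require Import complex.
From mathcomp Require Import all_classical all_reals all_analysis.

Set Implicit Arguments.
Unset Strict Implicit.
Unset Printing Implicit Defensive.

Import Order.TTheory GRing.Theory Num.Theory.
Import numFieldNormedType.Exports.

Local Open Scope classical_set_scope.
Local Open Scope ring_scope.
Local Open Scope complex_scope.

Section Defs.
Context {R : realType}.
Implicit Types (f g w psi : R -> R) (h : R -> R[i]) (D : set (R -> R)).

Local Notation mu := (@lebesgue_measure R).

Definition is_max d (T : porderType d) (A : set T) (m : T) :=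
  A m /\ ubound A m.

Definition is_min d (T : porderType d) (A : set T) (m : T) :=
  A m /\ lbound A m.

(* Functions on the circle are functions of the angle; only their values on
   [-pi, pi] are ever used. *)
Definition circle : set R := `[- pi, pi].

(* e^{ij\lambda} *)
Definition cexp (j : int) (l : R) : R[i] :=
  cos (j%:~R * l) +i* sin (j%:~R * l).

Definition cmeasurable h :=
  measurable_fun circle (fun l => complex.Re (h l)) /\
  measurable_fun circle (fun l => complex.Im (h l)).

Definition cabs (z : R[i]) : R := complex.Re `|z|.

(* (2 pi)^-1 times the integral over [-pi, pi]: of an extended-real function,
   and of a complex function (componentwise) *)
Definition mean (F : R -> \bar R) : \bar R :=
  ((2 * pi)^-1%:E * \int[mu]_(l in circle) F l)%E.

Definition cmean h : R[i] :=
  ((2 * pi)^-1 * \int[mu]_(l in circle) complex.Re (h l)) +i*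
  ((2 * pi)^-1 * \int[mu]_(l in circle) complex.Im (h l)).

(* The spectral densities of stationary sequences are exactly the nonnegative
   integrable functions (Herglotz). *)
Definition spectral_density f :=
  (forall l, circle l -> 0 <= f l) /\
  mu.-integrable circle (EFin \o f).

(* Integrability of 1/(f+g), with 1/0 = +oo: the inverse is that of \bar R.
   In R one has 0^-1 = 0, so the real inverse would ignore the zeros of f+g. *)
Definition inv_integrable f g :=
  (\int[mu]_(l in circle) ((f l + g l)%:E)^-1 < +oo)%E.

Definition power_class (P : R) : set (R -> R) :=
  [set g | spectral_density g /\ (mean (EFin \o g) <= P%:E)%E].

Definition sqnorm w h : \bar R :=
  mean (fun l => (cabs (h l) ^+ 2 * w l)%:E).

Definition L2 w : set (R -> R[i]) :=
  [set h | cmeasurable h /\ (sqnorm w h < +oo)%E].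

(* Linear span of the e^{ij\lambda} with j outside {0, ..., N} *)
Definition outer_span (N : nat) : set (R -> R[i]) :=
  [set p | exists (s : seq int) (c : int -> R[i]),
     all (fun j => (j < 0) || (N%:Z < j)) s /\
     p = fun l => \sum_(j <- s) c j * cexp j l].

(* Closure of the span in L2 w *)
Definition L2N (N : nat) w : set (R -> R[i]) :=
  [set h | L2 w h /\
     forall e : R, 0 < e -> exists2 p, outer_span N p &
       (sqnorm w (fun l => h l - p l)%R < e%:E)%E].

(* sum_j c_j e^{ij\lambda} *)
Definition trig (N : nat) (c : 'cV[R[i]]_N.+1) (l : R) : R[i] :=
  \sum_(j < N.+1) c j 0 * cexp j%:Z l.

Definition Delta (N : nat) (a : 'cV[R[i]]_N.+1) h f g : \bar R :=
  (sqnorm f (fun l => trig a l - h l)%R + sqnorm g h)%E.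

(* h is a spectral characteristic h(f,g) of the optimal linear estimate *)
Definition optimal_char (N : nat) (a : 'cV[R[i]]_N.+1) f g h :=
  L2N N (fun l => f l + g l) h /\
  forall h', L2N N (fun l => f l + g l) h' ->
    (Delta a h f g <= Delta a h' f g)%E.

Definition least_favourable (N : nat) (a : 'cV[R[i]]_N.+1) f D g0 :=
  D g0 /\
  exists2 h0, optimal_char a f g0 h0 &
    is_max [set v | exists g h,
              [/\ D g, optimal_char a f g h & v = Delta a h f g]]
           (Delta a h0 f g0).

Definition HD (N : nat) f D : set (R -> R[i]) :=
  [set h | forall g, D g -> L2N N (fun l => f l + g l) h].

Definition worst_error (N : nat) (a : 'cV[R[i]]_N.+1) f D h : \bar R :=
  ereal_sup [set Delta a h f g | g in D].

Definition minimax_robust (N : nat) (a : 'cV[R[i]]_N.+1) f D h0 :=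
  HD N f D h0 /\
  is_min [set worst_error a f D h | h in HD N f D] (worst_error a f D h0).

Definition toeplitz (N : nat) psi : 'M[R[i]]_N.+1 :=
  \matrix_(j, k) cmean (fun l => cexp (- (j%:Z - k%:Z)) l * (psi l)%:C).

Definition matB N f g := toeplitz N (fun l => (f l + g l)^-1).
Definition matR N f g := toeplitz N (fun l => f l / (f l + g l)).
Definition matQ N f g := toeplitz N (fun l => f l * g l / (f l + g l)).

Definition inner (n : nat) (x y : 'cV[R[i]]_n) : R[i] :=
  \sum_k x k 0 * conjc (y k 0).

(* The sum is real, B and Q being Hermitian; Re only changes its type. *)
Definition objective (N : nat) (a : 'cV[R[i]]_N.+1) f g : R :=
  complex.Re
    (inner (matR N f g *m a) (invmx (matB N f g) *m (matR N f g *m a)) +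
     inner (matQ N f g *m a) a).

Definition CN (N : nat) (a : 'cV[R[i]]_N.+1) f g : R -> R[i] :=
  trig (invmx (matB N f g) *m (matR N f g *m a)).

(* A_N f - C_N *)
Definition numer (N : nat) (a : 'cV[R[i]]_N.+1) f g (l : R) : R[i] :=
  trig a l * (f l)%:C - CN a f g l.

End Defs.

(* Main.v *)
(** Write w = f + g and h(f,g) = (A_N f - C_N) / w.  Since B_N c = R_N a, the
    Fourier coefficients of h(f,g) with index in 0..N vanish; an element h of
    L_2^N(w) satisfies Re <h, C_N> = 0 by approximation.  Completing the square
    then gives Delta(h;f,g) = Delta(h(f,g);f,g) + ||h - h(f,g)||^2_w, and the
    objective is Delta(h(f,g);f,g).

    When h0 = h(f,g0) is bounded, it lies in L_2^N(f+g) for every g: trigonometric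
    polynomials are dense in the weighted L_2, and the coefficients 0..N of an
    approximant can be subtracted at small cost.

    The formula for g0 says |h0| <= alpha2, with equality where g0 > 0.  If g0
    exhausts the power P2, this yields Delta(h0;f,g) <= Delta(h0;f,g0) for all g
    in the class.  If not, comparing g0 with g0 + eps in the optimization problem
    forces h0 = 0, and the same inequality is trivial.  So (h0, g0) is a saddle
    point, from which both claims follow. *)

Require Import Defs.
From mathcomp Require Import all_boot all_order all_algebra.
From mathcomp Require Import complex.
From mathcomp Require Import all_classical all_reals all_analysis.
From mathcomp Require Import measurable_realfun ring lra.

Set Implicit Arguments.
Unset Strict Implicit.
Unset Printing Implicit Defensive.

Import Order.TTheory GRing.Theory Num.Theory.
Import numFieldNormedType.Exports.

Local Open Scope classical_set_scope.
Local Open Scope ring_scope.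
Local Open Scope complex_scope.

(** Such a [g] is therefore reached only through Delta(h; f, g) at the fixed h = h0. For fixed h
    this error is affine in [g], and the bound on |h0|, integrated against [g], controls it. For h0
    to compete at every [g], trigonometric polynomials must be dense for all integrable weights,
    which may be unbounded and may vanish on large sets. Density is obtained through uniformly
    bounded sequences converging almost everywhere: dominated convergence then serves every weight
    at once. Indicators of rays come from explicit polynomials, Borel sets from a Dynkin class, and
    functions with values in [0, 1] from their binary digits. *)

(** * Normalized real means over the circle *)

Section Mean.
Context {R : realType}.
Implicit Types (F G : R -> R).
Local Notation mu := (@lebesgue_measure R).

Definition itg F := mu.-integrable circle (EFin \o F).
Definition meas F := measurable_fun circle F.
(** An infinite integral has real value 0 here, which is why linearity and monotonicity below carry
    integrability hypotheses. *)
Definition rmean F : R := (2 * pi)^-1 * \int[mu]_(l in circle) F l.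
Definition aec (P : R -> Prop) := {ae mu, forall l, circle l -> P l}.

Lemma pi2_gt0 : 0 < 2 * pi :> R.
Proof. by rewrite mulr_gt0// pi_gt0. Qed.

Lemma measurable_circle : measurable (circle : set R).
Proof. exact: measurable_itv. Qed.
Local Hint Resolve measurable_circle : core.

Lemma mu_circle : mu circle = (2 * pi)%:E.
Proof.
rewrite /circle lebesgue_measure_itv/= lte_fin ifT; last first.
  by rewrite gtrN// pi_gt0.
by rewrite -EFinB opprK mulrDl mul1r.
Qed.

Lemma aecW (P : R -> Prop) : (forall l, circle l -> P l) -> aec P.
Proof. by move=> h; apply: aeW. Qed.

Lemma aecS (P Q : R -> Prop) : (forall l, circle l -> P l -> Q l) -> aec P -> aec Q.
Proof. by move=> h; apply: (@filterS _ (almost_everywhere mu)) => l Pl cl; exact: h cl (Pl cl). Qed.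

Lemma aecS2 (P Q S : R -> Prop) : (forall l, circle l -> P l -> Q l -> S l) ->
  aec P -> aec Q -> aec S.
Proof. by move=> h; apply: (@filterS2 _ (almost_everywhere mu)) => l Pl Ql cl; exact: h cl (Pl cl) (Ql cl). Qed.

Lemma itg_meas F : itg F -> meas F.
Proof. by move=> /integrableP[/measurable_EFinP]. Qed.

Lemma itg_le F G : meas F -> itg G -> aec (fun l => `|F l| <= G l) -> itg F.
Proof.
move=> mF iG FG; have mG := itg_meas iG.
have/integrableP[mG' iG'] := iG.
apply/integrableP; split; first exact/measurable_EFinP.
apply: le_lt_trans iG'.
apply: ae_ge0_le_integral => //.
- by apply/measurable_EFinP; exact: measurableT_comp.
- by apply/measurable_EFinP; exact: measurableT_comp.
apply: aecS FG => l cl FG /=; rewrite lee_fin (le_trans FG)//.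
exact: ler_norm.
Qed.

Lemma itg_cst c : itg (fun=> c).
Proof.
apply/integrableP; split; first by apply/measurable_EFinP; exact: measurable_cst.
rewrite (_ : (fun x => _) = cst `|c%:E|%E)//.
by rewrite integral_cst//= mu_circle -EFinM ltry.
Qed.

Lemma itgD F G : itg F -> itg G -> itg (fun l => F l + G l).
Proof. by move=> iF iG; exact: (integrableD _ iF iG). Qed.

Lemma itgZ c F : itg F -> itg (fun l => c * F l).
Proof. by move=> iF; exact: (integrableZl _ _ iF). Qed.

Lemma itgB F G : itg F -> itg G -> itg (fun l => F l - G l).
Proof. by move=> iF iG; exact: (integrableB _ iF iG). Qed.

Lemma itg_mul_bounded F G M : meas F -> aec (fun l => `|F l| <= M) -> itg G ->
  itg (fun l => F l * G l).
Proof.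
move=> mF FM iG; have mG := itg_meas iG.
have iG' : itg (fun l => M * `|G l|).
  apply: itgZ; apply: (integrable_abse iG).
apply: itg_le iG' _; first exact: measurable_funM.
by apply: aecS FM => l _ FM; rewrite normrM ler_wpM2r.
Qed.

Lemma itg_fin_num F : itg F -> (\int[mu]_(l in circle) (F l)%:E)%E \is a fin_num.
Proof. exact: integrable_fin_num. Qed.

Lemma mean_rmean F : itg F -> mean (EFin \o F) = (rmean F)%:E.
Proof.
move=> iF; rewrite /mean /rmean EFinM; congr (_ * _)%E.
by rewrite fineK//; exact: itg_fin_num.
Qed.

Lemma mean_fin F : meas F -> (forall l, circle l -> 0 <= F l) ->
  (mean (EFin \o F) < +oo)%E -> itg F.
Proof.
move=> mF F0 Foo; apply/integrableP; split; first exact/measurable_EFinP.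
have -> : (\int[mu]_(x in circle) `|(EFin \o F) x| =
    \int[mu]_(x in circle) (EFin \o F) x)%E.
  by apply: eq_integral => l /set_mem cl /=; rewrite ger0_norm// F0.
rewrite ltey; apply/eqP => E; move: Foo; rewrite /mean E gt0_muley ?ltxx//.
by rewrite lte_fin invr_gt0 pi2_gt0.
Qed.

Lemma rmeanD F G : itg F -> itg G -> rmean (fun l => F l + G l) = rmean F + rmean G.
Proof. by move=> iF iG; rewrite /rmean RintegralD// mulrDr. Qed.

Lemma rmeanB F G : itg F -> itg G -> rmean (fun l => F l - G l) = rmean F - rmean G.
Proof. by move=> iF iG; rewrite /rmean RintegralB// mulrBr. Qed.

Lemma rmeanZ c F : itg F -> rmean (fun l => c * F l) = c * rmean F.
Proof. by move=> iF; rewrite /rmean RintegralZl// mulrCA. Qed.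

Lemma rmean_cst c : rmean (fun=> c) = c.
Proof.
have -> : rmean (fun=> c) = (2 * pi)^-1 * (c * fine (mu circle)).
  by congr (_ * _); exact: Rintegral_cst.
rewrite mu_circle /=.
by rewrite mulrCA mulVf ?mulr1// gt_eqF// pi2_gt0.
Qed.

Lemma rmean_ge0 F : (forall l, circle l -> 0 <= F l) -> 0 <= rmean F.
Proof.
move=> F0; apply: mulr_ge0; first by rewrite invr_ge0 ltW// pi2_gt0.
exact: Rintegral_ge0.
Qed.

Lemma rmean_ae F G : meas F -> meas G -> aec (fun l => F l = G l) ->
  rmean F = rmean G.
Proof.
move=> mF mG FG; rewrite /rmean /Rintegral; congr (_ * fine _).
apply: ae_eq_integral => //; try exact/measurable_EFinP.
by apply: (aecS _ FG) => l _ /= ->.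
Qed.

Lemma rmean_le F G : itg F -> itg G -> aec (fun l => F l <= G l) ->
  rmean F <= rmean G.
Proof.
move=> iF iG FG.
(* [max F G] agrees with [G] almost everywhere and dominates [F] at every point, so the comparison
   becomes pointwise. *)
have iM : itg (fun l => Num.max (F l) (G l)).
  apply: (@itg_le _ (fun l => `|F l| + `|G l|)).
  - by apply: measurable_maxr; exact: itg_meas.
  - by apply: itgD; exact: (integrable_abse (f := EFin \o _)).
  - apply: aecW => l _; rewrite maxEle; case: ifP => _; rewrite ?lerDr ?lerDl//.
rewrite (@rmean_ae G (fun l => Num.max (F l) (G l))).
- rewrite ler_pM2l ?invr_gt0 ?pi2_gt0//; apply: le_Rintegral => // l _.
  by rewrite le_max lexx.
- exact: itg_meas.
- exact: itg_meas.
- by apply: aecS FG => l _ FG; rewrite max_r.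
Qed.

Lemma rmean_eq0 F : itg F -> (forall l, circle l -> 0 <= F l) -> rmean F <= 0 ->
  aec (fun l => F l = 0).
Proof.
move=> iF F0 le0; have mF := itg_meas iF.
have /ae_eq_integral_abs : (\int[mu]_(x in circle) `|(EFin \o F) x| = 0)%E.
  have -> : (\int[mu]_(x in circle) `|(EFin \o F) x| =
      \int[mu]_(x in circle) (EFin \o F) x)%E.
    by apply: eq_integral => l /set_mem cl /=; rewrite ger0_norm// F0.
  have fn : (\int[mu]_(x in circle) (EFin \o F) x)%E \is a fin_num.
    exact: integrable_fin_num.
  apply/eqP; rewrite eq_le integral_ge0 ?andbT; last first.
    by move=> l cl; rewrite lee_fin F0.
  rewrite -(fineK fn) lee_fin.
  by move: le0; rewrite /rmean pmulr_rle0// invr_gt0 pi2_gt0.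
move=> h; have : aec (fun l => (F l)%:E = 0%E).
  by apply: h => //; exact/measurable_EFinP.
by apply: aecS => l _ [].
Qed.

End Mean.
#[global] Hint Resolve measurable_circle : core.

(** * Complex numbers through their real and imaginary parts; exponentials *)

Section ComplexParts.
Context {R : realType}.
Implicit Types (x y : R[i]) (c : R).

Lemma ReD x y : complex.Re (x + y) = complex.Re x + complex.Re y.
Proof. by case: x; case: y. Qed.

Lemma ImD x y : complex.Im (x + y) = complex.Im x + complex.Im y.
Proof. by case: x; case: y. Qed.

Lemma ReN x : complex.Re (- x) = - complex.Re x.
Proof. by case: x. Qed.

Lemma ImN x : complex.Im (- x) = - complex.Im x.
Proof. by case: x. Qed.

Lemma ReM x y : complex.Re (x * y) =
  complex.Re x * complex.Re y - complex.Im x * complex.Im y.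
Proof. by case: x; case: y. Qed.

Lemma ImM x y : complex.Im (x * y) =
  complex.Re x * complex.Im y + complex.Im x * complex.Re y.
Proof. by case: x; case: y. Qed.

Lemma Re_conjc x : complex.Re (conjc x) = complex.Re x.
Proof. by case: x. Qed.

Lemma Im_conjc x : complex.Im (conjc x) = - complex.Im x.
Proof. by case: x. Qed.

Lemma complex_ext x y : complex.Re x = complex.Re y ->
  complex.Im x = complex.Im y -> x = y.
Proof. by case: x; case: y => a b c d /= -> ->. Qed.

(** The squared modulus as a polynomial in the two parts, so that quadratic identities reduce to
    [ring]. *)
Definition nsq x : R := complex.Re x ^+ 2 + complex.Im x ^+ 2.

Definition cE := (ReD, ImD, ReN, ImN, ReM, ImM, Re_conjc, Im_conjc).

Lemma cabsE x : cabs x ^+ 2 = nsq x.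
Proof. by rewrite /cabs normc_def/= sqr_sqrtr// addr_ge0 ?sqr_ge0. Qed.

Lemma cabs_ge0 x : 0 <= cabs x.
Proof. by rewrite /cabs normc_def/= sqrtr_ge0. Qed.

Lemma nsq_ge0 x : 0 <= nsq x.
Proof. by rewrite addr_ge0 ?sqr_ge0. Qed.

Lemma nsqM x y : nsq (x * y) = nsq x * nsq y.
Proof. by rewrite /nsq !cE; ring. Qed.

Lemma nsq_real c : nsq c%:C = c ^+ 2.
Proof. by rewrite /nsq/= expr0n addr0. Qed.

(** Parallelogram law with one square dropped. The factor 2 is the source of the constants 4 in
    later estimates. *)
Lemma nsqD_le x y : nsq (x + y) <= 2 * nsq x + 2 * nsq y.
Proof.
rewrite -subr_ge0 (_ : _ - _ = nsq (x - y)) ?nsq_ge0//.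
by rewrite /nsq !cE; ring.
Qed.

Lemma nsqN x : nsq (- x) = nsq x.
Proof. by rewrite /nsq !cE !sqrrN. Qed.

Lemma nsqB_le x y : nsq (x - y) <= 2 * nsq x + 2 * nsq y.
Proof. by rewrite (le_trans (nsqD_le _ _))// nsqN. Qed.

Lemma norm_Re_le x : `|complex.Re x| <= 1 + nsq x.
Proof.
have : 0 <= (`|complex.Re x| - 1) ^+ 2 by exact: sqr_ge0.
have : 0 <= complex.Im x ^+ 2 by exact: sqr_ge0.
by rewrite /nsq -[complex.Re x ^+ 2]real_normK ?num_real//; nra.
Qed.

Lemma norm_Im_le x : `|complex.Im x| <= 1 + nsq x.
Proof.
have : 0 <= (`|complex.Im x| - 1) ^+ 2 by exact: sqr_ge0.
have : 0 <= complex.Re x ^+ 2 by exact: sqr_ge0.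
by rewrite /nsq -[complex.Im x ^+ 2]real_normK ?num_real//; nra.
Qed.

Lemma nsq_eq0 x : nsq x = 0 -> x = 0.
Proof.
move=> /eqP; rewrite paddr_eq0 ?sqr_ge0// !sqrf_eq0 => /andP[/eqP a /eqP b].
exact: complex_ext.
Qed.

Lemma conjcM x y : conjc (x * y) = conjc x * conjc y.
Proof. by apply: complex_ext; rewrite !cE; ring. Qed.

Lemma conjcD x y : conjc (x + y) = conjc x + conjc y.
Proof. by apply: complex_ext; rewrite !cE; ring. Qed.

Lemma conjc_sum (I : Type) (r : seq I) (P : pred I) (F : I -> R[i]) :
  conjc (\sum_(i <- r | P i) F i) = \sum_(i <- r | P i) conjc (F i).
Proof. by apply: (big_morph _ conjcD); apply: complex_ext; rewrite /= ?oppr0. Qed.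

Lemma cexp0 (l : R) : cexp 0 l = 1.
Proof. by rewrite /cexp mul0r cos0 sin0. Qed.

Lemma cexpD (j k : int) (l : R) : cexp (j + k) l = cexp j l * cexp k l.
Proof.
rewrite /cexp intrD mulrDl cosD sinD; apply: complex_ext; rewrite !cE//=.
by rewrite addrC.
Qed.

Lemma cexpN (j : int) (l : R) : cexp (- j) l = conjc (cexp j l).
Proof. by rewrite /cexp intrN mulNr cosN sinN. Qed.

Lemma nsq_cexp (j : int) (l : R) : nsq (cexp j l) = 1.
Proof. by rewrite /nsq/= cos2Dsin2. Qed.

End ComplexParts.

(** * Complex means and orthogonality of the exponentials *)

Section ComplexMean.
Context {R : realType}.
Implicit Types (h k : R -> R[i]) (F G : R -> R).
Local Notation mu := (@lebesgue_measure R).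

Definition citg h := itg (fun l => complex.Re (h l)) /\ itg (fun l => complex.Im (h l)).

Lemma cmeanE h : cmean h =
  rmean (fun l => complex.Re (h l)) +i* rmean (fun l => complex.Im (h l)).
Proof. by []. Qed.

Lemma citgD h k : citg h -> citg k -> citg (fun l => h l + k l).
Proof.
move=> [a b] [c d]; split.
- by under eq_fun do rewrite ReD; exact: itgD.
- by under eq_fun do rewrite ImD; exact: itgD.
Qed.

Lemma citgZ (c : R[i]) h : citg h -> citg (fun l => c * h l).
Proof.
move=> [a b]; split.
- by under eq_fun do rewrite ReM; apply: itgB; exact: itgZ.
- by under eq_fun do rewrite ImM; apply: itgD; exact: itgZ.
Qed.

Lemma citg0 : citg (fun=> 0).
Proof. by split; exact: itg_cst. Qed.

Lemma citg_sum (I : Type) (r : seq I) (P : pred I) (F : I -> R -> R[i]) :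
  (forall i, P i -> citg (F i)) -> citg (fun l => \sum_(i <- r | P i) F i l).
Proof.
move=> iF; elim: r => [|i r IH].
  by under eq_fun do rewrite big_nil; exact: citg0.
under eq_fun do rewrite big_cons.
case: (boolP (P i)) => [Pi|_]; last exact: IH.
by apply: citgD => //; exact: iF.
Qed.

Lemma cmeanD h k : citg h -> citg k ->
  cmean (fun l => h l + k l) = cmean h + cmean k.
Proof.
move=> [a b] [c d]; rewrite !cmeanE; apply: complex_ext; rewrite !cE/=.
- by under eq_fun do rewrite ReD; exact: rmeanD.
- by under eq_fun do rewrite ImD; exact: rmeanD.
Qed.

Lemma cmeanZ (c : R[i]) h : citg h -> cmean (fun l => c * h l) = c * cmean h.
Proof.
move=> [a b]; rewrite !cmeanE; apply: complex_ext; rewrite !cE/=.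
- under eq_fun do rewrite ReM.
  by rewrite rmeanB ?rmeanZ//; exact: itgZ.
- under eq_fun do rewrite ImM.
  by rewrite rmeanD ?rmeanZ//; exact: itgZ.
Qed.

Lemma cmean0 : cmean (fun=> 0 : R[i]) = 0.
Proof. by rewrite cmeanE/= rmean_cst. Qed.

Lemma cmean_sum (I : Type) (r : seq I) (P : pred I) (F : I -> R -> R[i]) :
  (forall i, P i -> citg (F i)) ->
  cmean (fun l => \sum_(i <- r | P i) F i l) = \sum_(i <- r | P i) cmean (F i).
Proof.
move=> iF; elim: r => [|i r IH].
  by rewrite [RHS]big_nil -[RHS]cmean0; under eq_fun do rewrite big_nil.
rewrite big_cons; under eq_fun do rewrite big_cons.
case: (boolP (P i)) => [Pi|_]; last exact: IH.
rewrite cmeanD ?IH//; first exact: iF.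
exact: citg_sum.
Qed.

Lemma cmeasurableD h k : cmeasurable h -> cmeasurable k ->
  cmeasurable (fun l => h l + k l).
Proof.
move=> [a b] [c d]; split.
- by under eq_fun do rewrite ReD; exact: measurable_funD.
- by under eq_fun do rewrite ImD; exact: measurable_funD.
Qed.

Lemma cmeasurableM h k : cmeasurable h -> cmeasurable k ->
  cmeasurable (fun l => h l * k l).
Proof.
move=> [a b] [c d]; split.
- under eq_fun do rewrite ReM.
  by apply: measurable_funB; exact: measurable_funM.
- under eq_fun do rewrite ImM.
  by apply: measurable_funD; exact: measurable_funM.
Qed.

Lemma cmeasurable_cst (c : R[i]) : cmeasurable (fun=> c).
Proof. by split; exact: measurable_cst. Qed.

Lemma cmeasurable_real F : meas F -> cmeasurable (fun l => (F l)%:C).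
Proof. by move=> mF; split => //=; exact: measurable_cst. Qed.

Lemma cmeasurableB h k : cmeasurable h -> cmeasurable k ->
  cmeasurable (fun l => h l - k l).
Proof.
move=> mh mk; apply: cmeasurableD => //.
have := cmeasurableM (cmeasurable_cst (-1)) mk.
by congr cmeasurable; apply/funext => l; rewrite mulN1r.
Qed.

Lemma cmeasurable_conj h : cmeasurable h -> cmeasurable (fun l => conjc (h l)).
Proof.
move=> [a b]; split.
- by under eq_fun do rewrite Re_conjc.
- under eq_fun do rewrite Im_conjc.
  exact: measurable_funN.
Qed.

Lemma meas_nsq h : cmeasurable h -> meas (fun l => nsq (h l)).
Proof. by move=> [a b]; apply: measurable_funD; exact: measurable_funX. Qed.

Lemma cmeasurable_cexp (j : int) : cmeasurable (@cexp R j).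
Proof.
by split; apply: measurable_funTS; apply: continuous_measurable_fun => x /=;
  apply: continuous_comp; [exact: mulrl_continuous|exact: continuous_cos
   |exact: mulrl_continuous|exact: continuous_sin].
Qed.

Lemma sin_int_pi (j : int) : sin (j%:~R * pi) = 0 :> R.
Proof.
have H n : sin (n%:R * pi) = 0 :> R.
  elim: n => [|n IH]; first by rewrite mul0r sin0.
  by rewrite -natr1 mulrDl mul1r sinD IH sinpi mulr0 mul0r addr0.
case: j => n; first exact: H.
by rewrite NegzE intrN mulNr sinN H oppr0.
Qed.

Lemma rmean_derive (F f : R -> R) : continuous f ->
  (forall x : R, is_derive x (1 : R) F (f x)) ->
  rmean f = (2 * pi)^-1 * (F pi - F (- pi)).
Proof.
move=> cf dF; have cF : continuous F.
  by move=> x; apply: differentiable_continuous; apply/derivable1_diffP.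
congr (_ * _); rewrite /Rintegral /circle (@continuous_FTC2 _ _ F)//.
- by rewrite gtrN// pi_gt0.
- exact: continuous_subspaceT.
- split; first by move=> x _.
  + exact: cvg_at_right_filter (cF _).
  + exact: cvg_at_left_filter (cF _).
- by move=> x _; rewrite derive1E; exact: derive_val.
Qed.

(** For j != 0 the antiderivatives are sin(jl)/j and -cos(jl)/j. The first vanishes at both ends of
    the circle; the second takes equal values there because the cosine is even. *)
Lemma cmean_cexp (j : int) : cmean (@cexp R j) = (j == 0)%:R.
Proof.
have [->|j0] := eqVneq j 0.
  rewrite (_ : cexp 0 = fun=> 1); last by apply/funext => l; rewrite cexp0.
  by rewrite cmeanE/= !rmean_cst.
have jR0 : j%:~R != 0 :> R by rewrite intr_eq0.
have dm (x : R) : is_derive x (1 : R) (fun l => j%:~R * l : R) j%:~R.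
  have := @is_deriveZ _ _ _ (id : R -> R) j%:~R x 1 1 (is_derive_id x 1).
  by rewrite /GRing.scale/= mulr1.
have ds (x : R) : is_derive x (1 : R) (fun l => j%:~R^-1 * sin (j%:~R * l) : R)
    (cos (j%:~R * x)).
  have d1 := @is_derive1_comp _ sin _ x _ _ (is_derive_sin (j%:~R * x)) (dm x).
  have := @is_deriveZ _ _ _ _ j%:~R^-1 x 1 _ d1.
  by rewrite /GRing.scale/= mulrC mulfK.
have dc (x : R) : is_derive x (1 : R) (fun l => - j%:~R^-1 * cos (j%:~R * l) : R)
    (sin (j%:~R * x)).
  have d1 := @is_derive1_comp _ cos _ x _ _ (is_derive_cos (j%:~R * x)) (dm x).
  have := @is_deriveZ _ _ _ _ (- j%:~R^-1) x 1 _ d1.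
  by rewrite mulNr /GRing.scale/= mulrNN mulrC mulfK.
rewrite cmeanE; apply: complex_ext => /=.
- rewrite (rmean_derive _ ds).
  + by rewrite mulrN sinN sin_int_pi oppr0 !mulr0 subrr mulr0.
  + by move=> x; apply: continuous_comp; [exact: mulrl_continuous|exact: continuous_cos].
- rewrite (rmean_derive _ dc).
  + by rewrite mulrN cosN subrr mulr0.
  + by move=> x; apply: continuous_comp; [exact: mulrl_continuous|exact: continuous_sin].
Qed.

End ComplexMean.

(** * Weighted square means, trigonometric polynomials and their closure *)

Section WeightedL2.
Context {R : realType}.
Implicit Types (h k p : R -> R[i]) (v w F G : R -> R).
Local Notation mu := (@lebesgue_measure R).

(* The real-valued counterpart of [sqnorm v h]. *)
Definition sqmean v h : R := rmean (fun l => nsq (h l) * v l).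
Definition l2 v h := cmeasurable h /\ itg (fun l => nsq (h l) * v l).
(** The bound is only almost everywhere because the boundedness assumed of the spectral
    characteristic is. *)
Definition cbd h := cmeasurable h /\ exists M : R, aec (fun l => nsq (h l) <= M).

Lemma cbdD h k : cbd h -> cbd k -> cbd (fun l => h l + k l).
Proof.
move=> [mh [M hM]] [mk [K kK]]; split; first exact: cmeasurableD.
exists (2 * M + 2 * K); apply: (aecS2 _ hM kK) => l _ a b.
by apply: le_trans (nsqD_le _ _) _; lra.
Qed.

Lemma cbdM h k : cbd h -> cbd k -> cbd (fun l => h l * k l).
Proof.
move=> [mh [M hM]] [mk [K kK]]; split; first exact: cmeasurableM.
exists (M * K); apply: (aecS2 _ hM kK) => l _ a b.
by rewrite nsqM ler_pM ?nsq_ge0.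
Qed.

Lemma cbd_cst (c : R[i]) : cbd (fun=> c).
Proof. by split; [exact: cmeasurable_cst|exists (nsq c); apply: aecW]. Qed.

Lemma cbdB h k : cbd h -> cbd k -> cbd (fun l => h l - k l).
Proof.
move=> bh bk; apply: cbdD => //.
have := cbdM (cbd_cst (-1)) bk; congr cbd; apply/funext => l.
by rewrite mulN1r.
Qed.

Lemma cbd_cexp (j : int) : cbd (@cexp R j).
Proof.
split; first exact: cmeasurable_cexp.
by exists 1; apply: aecW => l _; rewrite nsq_cexp.
Qed.

Lemma cbd_sum (I : Type) (r : seq I) (F : I -> R -> R[i]) :
  (forall i, cbd (F i)) -> cbd (fun l => \sum_(i <- r) F i l).
Proof.
move=> bF; elim: r => [|i r IH].
  by under eq_fun do rewrite big_nil; exact: cbd_cst.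
by under eq_fun do rewrite big_cons; exact: cbdD.
Qed.

Lemma cbd_real F M : meas F -> (forall l, circle l -> `|F l| <= M) ->
  cbd (fun l => (F l)%:C).
Proof.
move=> mF FM; split; first exact: cmeasurable_real.
exists (M ^+ 2); apply: aecW => l cl; rewrite nsq_real -real_normK ?num_real//.
by rewrite lerXn2r ?nnegrE ?(le_trans _ (FM l cl))// FM.
Qed.

Lemma cbd_Re h : cbd h ->
  exists K, aec (fun l => `|complex.Re (h l)| <= K).
Proof.
move=> [_ [M hM]]; exists (1 + M); apply: aecS hM => l _ hM.
by rewrite (le_trans (norm_Re_le _))// lerD2l.
Qed.

Lemma cbd_Im h : cbd h ->
  exists K, aec (fun l => `|complex.Im (h l)| <= K).
Proof.
move=> [_ [M hM]]; exists (1 + M); apply: aecS hM => l _ hM.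
by rewrite (le_trans (norm_Im_le _))// lerD2l.
Qed.

Lemma cbd_citg h : cbd h -> citg h.
Proof.
move=> bh; have [[mR mI] _] := bh.
have [[K hK] [L hL]] := (conj (cbd_Re bh) (cbd_Im bh)).
by split; [apply: itg_le (itg_cst K) hK|apply: itg_le (itg_cst L) hL].
Qed.

Lemma cbd_l2 v h : spectral_density v -> cbd h -> l2 v h.
Proof.
move=> [v0 iv] [mh [M hM]]; split => //.
apply: (@itg_mul_bounded _ _ _ M) => //; first exact: meas_nsq.
by apply: aecS hM => l _ a; rewrite ger0_norm// nsq_ge0.
Qed.

Lemma l2D v h k : spectral_density v -> l2 v h -> l2 v k ->
  l2 v (fun l => h l + k l).
Proof.
move=> [v0 iv] [mh ih] [mk ik]; split; first exact: cmeasurableD.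
apply: (itg_le _ (itgD (itgZ 2 ih) (itgZ 2 ik))).
  by apply: measurable_funM; [apply: meas_nsq; exact: cmeasurableD|exact: itg_meas].
apply: aecW => l cl; rewrite ger0_norm ?mulr_ge0 ?nsq_ge0 ?v0//.
by rewrite !mulrA -mulrDl ler_wpM2r ?v0// nsqD_le.
Qed.

Lemma l2B v h k : spectral_density v -> l2 v h -> l2 v k ->
  l2 v (fun l => h l - k l).
Proof.
move=> [v0 iv] [mh ih] [mk ik]; split; first exact: cmeasurableB.
apply: (itg_le _ (itgD (itgZ 2 ih) (itgZ 2 ik))).
  by apply: measurable_funM; [apply: meas_nsq; exact: cmeasurableB|exact: itg_meas].
apply: aecW => l cl; rewrite ger0_norm ?mulr_ge0 ?nsq_ge0 ?v0//.
by rewrite !mulrA -mulrDl ler_wpM2r ?v0// nsqB_le.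
Qed.

Lemma sqmean_ge0 v h : spectral_density v -> 0 <= sqmean v h.
Proof. by move=> [v0 _]; apply: rmean_ge0 => l cl; rewrite mulr_ge0 ?nsq_ge0 ?v0. Qed.

Lemma sqmeanD_le v h k : spectral_density v -> l2 v h -> l2 v k ->
  sqmean v (fun l => h l + k l) <= 2 * sqmean v h + 2 * sqmean v k.
Proof.
move=> wv lh lk; have [_ ihk] := l2D wv lh lk.
have [[_ ih] [_ ik]] := (conj lh lk); have [v0 _] := wv.
rewrite -!rmeanZ// -rmeanD; [|exact: itgZ..].
apply: rmean_le => //; first by apply: itgD; exact: itgZ.
apply: aecW => l cl; rewrite !mulrA -mulrDl ler_wpM2r ?v0//.
exact: nsqD_le.
Qed.

Lemma sqmeanZ v h (c : R[i]) : l2 v h -> sqmean v (fun l => c * h l) = nsq c * sqmean v h.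
Proof.
move=> [_ ih]; rewrite -rmeanZ//; congr rmean; apply/funext => l.
by rewrite nsqM mulrA.
Qed.

Lemma sqmean_ae v h k : meas v -> cmeasurable h -> cmeasurable k ->
  aec (fun l => h l = k l) -> sqmean v h = sqmean v k.
Proof.
move=> mv mh mk hk; apply: rmean_ae.
- by apply: measurable_funM => //; exact: meas_nsq.
- by apply: measurable_funM => //; exact: meas_nsq.
- by apply: (aecS _ hk) => l _ ->.
Qed.

Lemma sqnormE v h : l2 v h -> sqnorm v h = (sqmean v h)%:E.
Proof.
move=> [_ ih]; rewrite -mean_rmean//; congr mean.
by apply/funext => l /=; rewrite cabsE.
Qed.

Lemma L2_l2 v h : spectral_density v -> L2 v h <-> l2 v h.
Proof.
move=> [v0 iv]; split => [[mh]|lh]; last first.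
  by split; [case: lh|rewrite sqnormE ?ltry].
rewrite /sqnorm; under [X in mean X]eq_fun do rewrite cabsE.
move=> hoo; split => //; apply: mean_fin hoo.
  by apply: measurable_funM; [exact: meas_nsq|exact: itg_meas].
by move=> l cl; rewrite mulr_ge0 ?nsq_ge0 ?v0.
Qed.

(** Nonnegativity of a variance: with m the mean of h, integrate 2 Re(h conj(m)) <= |h|^2 + |m|^2,
    whose left side has mean 2|m|^2. *)
Lemma nsq_cmean_le h : cbd h -> nsq (cmean h) <= rmean (fun l => nsq (h l)).
Proof.
move=> bh; have [iR iI] := cbd_citg bh; have [mh [M hM]] := bh.
have ih : itg (fun l => nsq (h l)).
  apply: (itg_le _ (itg_cst M)); first exact: meas_nsq.
  by apply: aecS hM => l _; rewrite ger0_norm ?nsq_ge0.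
set m := cmean h; set a := complex.Re m; set b := complex.Im m.
have -> : nsq m = 2 * (a * a + b * b) - nsq m by rewrite /nsq -/a -/b; ring.
rewrite lerBlDr -[X in _ <= _ + X]rmean_cst -rmeanD//; last exact: itg_cst.
rewrite {2}/a {2}/b /m cmeanE/= -!rmeanZ// -rmeanD; [|exact: itgZ..].
rewrite -rmeanZ; last by apply: itgD; exact: itgZ.
apply: rmean_le.
- by apply: itgZ; apply: itgD; exact: itgZ.
- by apply: itgD => //; exact: itg_cst.
- apply: aecW => l _; rewrite -subr_ge0 (_ : _ - _ = nsq (h l - m)) ?nsq_ge0//.
  by rewrite /nsq !cE -/a -/b; ring.
Qed.

(** An inductive form makes closure under products a double induction resting on [cexpD], and lets
    linear statements be checked on single exponentials. *)
Inductive tpoly : (R -> R[i]) -> Prop :=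
| tpoly_cexp j : tpoly (cexp j)
| tpolyD p q : tpoly p -> tpoly q -> tpoly (fun l => p l + q l)
| tpolyZ c p : tpoly p -> tpoly (fun l => c * p l).

Lemma tpoly_cbd p : tpoly p -> cbd p.
Proof.
elim=> [j|p' q' _ bp _ bq|c p' _ bp]; first exact: cbd_cexp.
- exact: cbdD.
- by apply: cbdM => //; exact: cbd_cst.
Qed.

Lemma tpoly_cst (c : R[i]) : tpoly (fun=> c).
Proof.
have := tpolyZ c (tpoly_cexp 0); congr tpoly; apply/funext => l.
by rewrite cexp0 mulr1.
Qed.

Lemma tpolyM p q : tpoly p -> tpoly q -> tpoly (fun l => p l * q l).
Proof.
move=> tp; elim: tp q => [j|p1 p2 _ IH1 _ IH2|c p' _ IH] q tq.
- elim: tq => [k|q1 q2 _ IH1 _ IH2|c q' _ IH].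
  + by have := tpoly_cexp (j + k); congr tpoly; apply/funext => l; rewrite cexpD.
  + by have := tpolyD IH1 IH2; congr tpoly; apply/funext => l; rewrite mulrDr.
  + by have := tpolyZ c IH; congr tpoly; apply/funext => l; rewrite mulrCA.
- by have := tpolyD (IH1 _ tq) (IH2 _ tq); congr tpoly; apply/funext => l; rewrite mulrDl.
- by have := tpolyZ c (IH _ tq); congr tpoly; apply/funext => l; rewrite mulrA.
Qed.

Lemma tpolyX p n : tpoly p -> tpoly (fun l => p l ^+ n).
Proof.
move=> tp; elim: n => [|n IH]; first exact: tpoly_cst.
by have := tpolyM tp IH; congr tpoly; apply/funext => l; rewrite exprS.
Qed.

(** Membership in the L2(v)-closure of the trigonometric polynomials. It is meaningful when the
    square means are finite, hence the [cbd] hypotheses in the closure lemmas. *)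
Definition appr v h := forall e, 0 < e ->
  exists2 p, tpoly p & sqmean v (fun l => h l - p l) < e.

Lemma appr_tpoly v p : tpoly p -> appr v p.
Proof.
move=> tp e e0; exists p => //; rewrite /sqmean.
rewrite (_ : (fun _ => _) = fun=> 0) ?rmean_cst//.
by apply/funext => l; rewrite subrr /nsq/= expr0n addr0 mul0r.
Qed.

Lemma apprD v h k : spectral_density v -> cbd h -> cbd k ->
  appr v h -> appr v k -> appr v (fun l => h l + k l).
Proof.
move=> wv bh bk ah ak e e0.
(* [sqmeanD_le] doubles each of the two errors. *)
have e4 : 0 < e / 4 by lra.
have [p tp hp] := ah _ e4; have [q tq kq] := ak _ e4.
exists (fun l => p l + q l); first exact: tpolyD.
rewrite (_ : (fun _ => _) = fun l => (h l - p l) + (k l - q l)); last first.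
  by apply/funext => l; ring.
apply: le_lt_trans (sqmeanD_le wv _ _) _; last by lra.
- by apply: cbd_l2 => //; apply: cbdB => //; exact: tpoly_cbd.
- by apply: cbd_l2 => //; apply: cbdB => //; exact: tpoly_cbd.
Qed.

Lemma apprZ v h c : spectral_density v -> cbd h -> appr v h ->
  appr v (fun l => c * h l).
Proof.
move=> wv bh ah e e0; have c0 := nsq_ge0 c.
have [|p tp hp] := ah (e / (nsq c + 1)); first by rewrite divr_gt0//; lra.
exists (fun l => c * p l); first exact: tpolyZ.
under eq_fun do rewrite -mulrBr.
rewrite sqmeanZ; last by apply: cbd_l2 => //; apply: cbdB => //; exact: tpoly_cbd.
have := sqmean_ge0 (fun l => h l - p l) wv.
move: hp; rewrite ltr_pdivlMr; last by lra.
nra.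
Qed.

Lemma appr_closed v h : spectral_density v -> cbd h ->
  (forall e, 0 < e -> exists k,
     [/\ cbd k, appr v k & sqmean v (fun l => h l - k l) < e]) -> appr v h.
Proof.
move=> wv bh H e e0; have e4 : 0 < e / 4 by lra.
have [k [bk ak hk]] := H _ e4; have [p tp kp] := ak _ e4.
exists p => //.
rewrite (_ : (fun _ => _) = fun l => (h l - k l) + (k l - p l)); last first.
  by apply/funext => l; ring.
apply: le_lt_trans (sqmeanD_le wv _ _) _; last by lra.
- by apply: cbd_l2 => //; exact: cbdB.
- by apply: cbd_l2 => //; apply: cbdB => //; exact: tpoly_cbd.
Qed.

Lemma appr_ae v h k : spectral_density v -> cmeasurable h -> cmeasurable k ->
  aec (fun l => h l = k l) -> appr v h -> appr v k.
Proof.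
move=> [v0 iv] mh mk hk ah e e0; have [p tp hp] := ah _ e0; exists p => //.
have [mp _] := tpoly_cbd tp.
apply: le_lt_trans hp; rewrite le_eqVlt; apply/orP; left; apply/eqP.
apply: sqmean_ae; [exact: itg_meas|exact: cmeasurableB..|].
by apply: (aecS _ hk) => l _ ->.
Qed.

Lemma rmean_cvg0 (F_ : nat -> R -> R) G : (forall n, meas (F_ n)) -> itg G ->
  (forall n l, circle l -> `|F_ n l| <= G l) ->
  aec (fun l => F_ n l @[n --> \oo] --> 0) ->
  rmean (F_ n) @[n --> \oo] --> 0.
Proof.
move=> mF iG FG F0.
have [] := @dominated_convergence _ _ _ mu circle measurable_circle
  (fun n l => (F_ n l)%:E) (cst 0%E) (EFin \o G) _ _ _ iG _.
- by move=> n; apply/measurable_EFinP; exact: mF.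
- exact: measurable_cst.
- by apply: (aecS _ F0) => l _ Fl0; apply: cvg_EFin; [exact: nearW|exact: Fl0].
- by apply: aeW => l n cl; rewrite /= lee_fin FG.
move=> _ _; rewrite integral0 => /fine_cvgP[_ /= cF].
rewrite -(mulr0 (2 * pi)^-1); by apply: cvgM; [exact: cvg_cst|exact: cF].
Qed.

(** Dominated convergence: |h - h_n|^2 v <= 4 M v, and the right side is integrable whatever the
    weight. *)
Lemma appr_lim v (h_ : nat -> R -> R[i]) h M : spectral_density v ->
  cmeasurable h -> (forall n, cmeasurable (h_ n)) ->
  (forall l, circle l -> nsq (h l) <= M) ->
  (forall n l, circle l -> nsq (h_ n l) <= M) ->
  (forall n, appr v (h_ n)) ->
  aec (fun l => nsq (h l - h_ n l) @[n --> \oo] --> 0) -> appr v h.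
Proof.
move=> wv mh mh_ hM h_M ah_ cv; have [v0 iv] := wv.
apply: appr_closed => //; first by split => //; exists M; exact: aecW.
move=> e e0.
have : sqmean v (fun l => h l - h_ n l) @[n --> \oo] --> 0.
  apply: (@rmean_cvg0 _ (fun l => (4 * M) * v l)).
  - move=> n; apply: measurable_funM; last exact: itg_meas.
    by apply: meas_nsq; exact: cmeasurableB.
  - exact: itgZ.
  - move=> n l cl; rewrite ger0_norm ?mulr_ge0 ?nsq_ge0 ?v0//.
    rewrite ler_wpM2r ?v0//; apply: le_trans (nsqB_le _ _) _.
    by have := hM l cl; have := h_M n l cl; lra.
  - apply: (aecS _ cv) => l _ c; rewrite -(mul0r (v l)).
    by apply: cvgM; [exact: c|exact: cvg_cst].
move=> /cvgr0Pnorm_lt /(_ _ e0)[n _ /(_ n (leqnn n)) /= He].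
exists (h_ n); split => //.
  by split => //; exists M; apply: aecW; exact: h_M.
by apply: le_lt_trans He; exact: ler_norm.
Qed.

End WeightedL2.

(** * Density of trigonometric polynomials for an integrable weight *)

Section Density.
Context {R : realType}.
Implicit Types (v F : R -> R) (x l : R).
Local Notation mu := (@lebesgue_measure R).

(* [(1 - y^n)^(2^n)] tends to 1 for [y < 1/2] and to 0 for [y > 1/2]: it turns
   a polynomial [y] into approximations of the indicator of [y < 1/2]. *)
Definition steep (n : nat) (y : R) : R := (1 - y ^+ n) ^+ (2 ^ n).

Lemma bernoulli_lower (z : R) (m : nat) : 0 <= z -> z <= 1 ->
  1 - m%:R * z <= (1 - z) ^+ m.
Proof.
move=> z0 z1; elim: m => [|m IH]; first by rewrite expr0 mul0r subr0.
rewrite exprS -natr1.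
have := ler_wpM2l (_ : 0 <= 1 - z) IH; rewrite subr_ge0 => /(_ z1).
have : 0 <= m%:R :> R by [].
nra.
Qed.

(** An algebraic substitute for (1 - z)^m <= exp(- m z). The induction rests on (1 - z)(1 + (m + 1)
    z) <= 1 + m z. *)
Lemma bernoulli_upper (z : R) (m : nat) : 0 <= z -> z <= 1 ->
  (1 - z) ^+ m * (1 + m%:R * z) <= 1.
Proof.
move=> z0 z1; elim: m => [|m IH]; first by rewrite expr0 mul0r addr0 mulr1.
apply: le_trans IH; rewrite exprS -natr1 mulrAC mulrC ler_wpM2l//.
  by rewrite exprn_ge0// subr_ge0.
have : 0 <= m%:R :> R by [].
nra.
Qed.

Lemma steep_itv n y : 0 <= y -> y <= 1 -> 0 <= steep n y /\ steep n y <= 1.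
Proof.
move=> y0 y1; have z1 : y ^+ n <= 1 by exact: exprn_ile1.
have z0 : 0 <= y ^+ n by exact: exprn_ge0.
by split; [rewrite exprn_ge0// subr_ge0|rewrite exprn_ile1 ?subr_ge0//; lra].
Qed.

(** The exponent 2^n is chosen so that 2^n y^n = (2y)^n, which tends to 0 exactly for y < 1/2;
    Bernoulli gives [steep n y] >= 1 - (2y)^n. *)
Lemma steep_cvg1 y : 0 <= y -> y < 2^-1 -> steep n y @[n --> \oo] --> (1 : R).
Proof.
move=> y0 y2.
have c : 1 - (2 * y) ^+ n @[n --> \oo] --> (1 : R).
  rewrite -[X in _ --> X]subr0; apply: cvgB; first exact: cvg_cst.
  by apply: cvg_expr; rewrite ger0_norm; lra.
apply: (@squeeze_cvgr _ \oo _ R (fun n => 1 - (2 * y) ^+ n) (fun=> 1));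
  [|exact: c|exact: cvg_cst]; apply: nearW => n /=.
have y1 : y <= 1 by lra.
have [_ ->] := steep_itv n y0 y1; rewrite andbT exprMn -natrX.
by apply: bernoulli_lower; [exact: exprn_ge0|exact: exprn_ile1].
Qed.

(** Here (2y)^n grows, and the upper Bernoulli bound gives [steep n y] <= 1 / (1 + (2y)^n) <=
    (2y)^-n. *)
Lemma steep_cvg0 y : 2^-1 < y -> y <= 1 -> steep n y @[n --> \oo] --> (0 : R).
Proof.
move=> y2 y1; have y0 : 0 <= y by lra.
have c : (2 * y)^-1 ^+ n @[n --> \oo] --> (0 : R).
  apply: cvg_expr; rewrite ger0_norm ?invr_ge0; last by lra.
  by rewrite invf_lt1; lra.
apply: (@squeeze_cvgr _ \oo _ R (fun=> 0) (fun n => (2 * y)^-1 ^+ n));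
  [|exact: cvg_cst|exact: c]; apply: nearW => n /=.
have [-> _] := steep_itv n y0 y1; rewrite /=.
have := @bernoulli_upper (y ^+ n) (2 ^ n) (exprn_ge0 _ y0) (exprn_ile1 _ y0 y1).
rewrite natrX -exprMn -/(steep n y) exprVn.
have p : 0 < (2 * y) ^+ n by apply: exprn_gt0; lra.
have [s0 _] := steep_itv n y0 y1.
rewrite -[X in _ -> _ <= X]mul1r ler_pdivlMr//.
nra.
Qed.

(* A trigonometric polynomial in [l] with values in [0, 1] that, inside the
   circle, is below 1/2 exactly to the right of [x]; see [slopeE]. *)
Definition slope x l : R := 2^-1 - (sin (l - x / 2) - sin (x / 2)) / 4.

Lemma slope_itv x l : 0 <= slope x l /\ slope x l <= 1.
Proof.
have := sin_geN1 (l - x / 2); have := sin_le1 (l - x / 2).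
have := sin_geN1 (x / 2); have := sin_le1 (x / 2).
by rewrite /slope; split; lra.
Qed.

(** Sum-to-product. Inside the circle cos(l/2) > 0 and |(l - x)/2| < pi, so the sign of the product
    is that of l - x. Each factor has half-integer frequency, but their product has frequencies 0
    and 1 only, so [slope] is a trigonometric polynomial. *)
Lemma slopeE x l : slope x l = 2^-1 - cos (l / 2) * sin ((l - x) / 2) / 2.
Proof.
have e1 : l - x / 2 = (l - x) / 2 + l / 2 by field.
have e2 : x / 2 = l / 2 - (l - x) / 2 by field.
by rewrite /slope e1 [in sin (x / 2)]e2 sinD sinB; field.
Qed.

Lemma slope_lt x l : - pi < l < pi -> - pi <= x <= pi -> x < l -> slope x l < 2^-1.
Proof.
move=> /andP[l1 l2] /andP[x1 x2] xl; rewrite slopeE ltrBlDr ltrDl.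
have p0 := pi_gt0 R.
rewrite divr_gt0// mulr_gt0//.
- by apply: cos_gt0_pihalf; apply/andP; split; lra.
- by apply: sin_gt0_pi; apply/andP; split; lra.
Qed.

Lemma slope_gt x l : - pi < l < pi -> - pi <= x <= pi -> l < x -> 2^-1 < slope x l.
Proof.
move=> /andP[l1 l2] /andP[x1 x2] xl; rewrite slopeE.
have p0 := pi_gt0 R.
have c0 : 0 < cos (l / 2) by apply: cos_gt0_pihalf; apply/andP; split; lra.
have s0 : 0 < sin ((x - l) / 2) by apply: sin_gt0_pi; apply/andP; split; lra.
have -> : (l - x) / 2 = - ((x - l) / 2) by field.
by rewrite sinN; have := mulr_gt0 c0 s0; lra.
Qed.

Lemma tpoly_slope x n : tpoly (fun l => (steep n (slope x l))%:C).
Proof.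
have ts : tpoly (fun l => (slope x l)%:C).
  set s := sin (x / 2); set c := cos (x / 2).
  (* Chosen so that 2 Re(u e^{il}) = (s cos l - c sin l)/4, the part of [slope] that varies with
     l. *)
  pose u : R[i] := (s / 8) +i* (c / 8).
  have := tpolyD (tpoly_cst ((2^-1 + s / 4)%:C))
    (tpolyD (tpolyZ u (tpoly_cexp 1)) (tpolyZ (conjc u) (tpoly_cexp (-1)))).
  congr tpoly; apply/funext => l; rewrite cexpN /u /slope -/s sinB -/s -/c.
  by apply: complex_ext; rewrite !cE/= !mul1r; field.
have := tpolyX (2 ^ n) (tpolyD (tpoly_cst 1) (tpolyZ (-1) (tpolyX n ts))).
congr tpoly; apply/funext => l; rewrite /steep mulN1r.
by rewrite -!(rmorphXn (real_complex R)) -rmorphN -(rmorph1 (real_complex R))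
  -rmorphD -rmorphXn.
Qed.

Definition ind (A : set R) l : R[i] := (\1_A l)%:C.

Lemma cmeasurable_ind (A : set R) : measurable A -> cmeasurable (ind A).
Proof. by move=> mA; apply: cmeasurable_real; exact: measurable_indic. Qed.

Lemma nsq_ind_le (A : set R) l : nsq (ind A l) <= 1.
Proof.
by rewrite /ind nsq_real indicE; case: (_ \in _); rewrite ?expr1n// expr0n.
Qed.

Lemma cbd_ind (A : set R) : measurable A -> cbd (ind A).
Proof.
move=> mA; split; first exact: cmeasurable_ind.
by exists 1; apply: aecW => l _; exact: nsq_ind_le.
Qed.

Lemma aec_neq x : aec (fun l => l != x).
Proof.
exists [set x]; split; [exact: measurable_set1|exact: lebesgue_measure_set1|].
move=> l /= /not_implyP[_ /negP]; rewrite negbK => /eqP //.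
Qed.

Lemma appr_ray_itv v x : spectral_density v -> - pi <= x <= pi ->
  appr v (ind `]x, +oo[).
Proof.
move=> wv xp.
have mr : measurable (`]x, +oo[ : set R) by exact: measurable_itv.
apply: (@appr_lim _ _ (fun n l => (steep n (slope x l))%:C) _ 1) => //.
- exact: cmeasurable_ind.
- by move=> n; case: (tpoly_cbd (tpoly_slope x n)).
- by move=> l _; exact: nsq_ind_le.
- move=> n l _; rewrite nsq_real; have [s0 s1] := slope_itv x l.
  by have [a b] := steep_itv n s0 s1; rewrite expr_le1.
- by move=> n; apply: appr_tpoly; exact: tpoly_slope.
(* [slope x] equals 1/2 at l = x and, since cos(l/2) vanishes there, at both ends of the circle;
   these three points form a null set. *)
- have ends := aecS2 (fun l _ a b => conj a b) (aec_neq pi) (aec_neq (- pi)).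
  apply: (aecS2 _ ends (aec_neq x)) => l.
  rewrite /circle/= in_itv/= => /andP[l1 l2] [lp lNp] lx.
  have lpi : - pi < l < pi by rewrite !lt_neqAle l1 l2 lp eq_sym lNp.
  have [s0 s1] := slope_itv x l.
  rewrite /ind indicE mem_setE in_itv/= andbT.
  have [xl|xl] := ltP x l.
  + have c := steep_cvg1 s0 (slope_lt lpi xp xl).
    have : (1 - steep n (slope x l)) * (1 - steep n (slope x l)) @[n --> \oo]
        --> ((1 - 1) * (1 - 1) : R).
      by apply: cvgM; apply: cvgB => //; exact: cvg_cst.
    rewrite subrr mulr0.
    rewrite [X in _ -> X @ _ --> _](_ : _ =
      fun n => (1 - steep n (slope x l)) * (1 - steep n (slope x l)))//.
    by apply/funext => n; rewrite -rmorphB nsq_real expr2.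
  + have xl' : l < x by rewrite lt_neqAle lx.
    have c := steep_cvg0 (slope_gt lpi xp xl') s1.
    have : steep n (slope x l) * steep n (slope x l) @[n --> \oo] --> (0 * 0 : R).
      exact: cvgM.
    rewrite mulr0.
    rewrite [X in _ -> X @ _ --> _](_ : _ =
      fun n => steep n (slope x l) * steep n (slope x l))//.
    by apply/funext => n; rewrite -rmorphB nsq_real sub0r sqrrN expr2.
Qed.

Lemma appr_ray v x : spectral_density v -> appr v (ind `]x, +oo[).
Proof.
move=> wv; have mr : measurable (`]x, +oo[ : set R) by exact: measurable_itv.
have p0 := pi_gt0 R.
have [xp|xp] := ltP x (- pi).
  apply: (@appr_ae _ _ (fun=> 1)) => //.
  - exact: cmeasurable_ind.
  - apply: aecW => l; rewrite /circle/= in_itv/= => /andP[l1 l2].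
    by rewrite /ind indicE mem_setE in_itv/= andbT (lt_le_trans xp l1).
  - exact/appr_tpoly/tpoly_cst.
have [px|px] := ltP pi x.
  apply: (@appr_ae _ _ (fun=> 0)) => //.
  - exact: cmeasurable_ind.
  - apply: aecW => l; rewrite /circle/= in_itv/= => /andP[l1 l2].
    by rewrite /ind indicE mem_setE in_itv/= andbT ltNge (le_trans l2 (ltW px)).
  - exact/appr_tpoly/tpoly_cst.
by apply: appr_ray_itv => //; rewrite xp px.
Qed.

Lemma sum_ind_trivIset (F : nat -> set R) n k l : trivIset setT F -> F k l ->
  \sum_(i < n) ind (F i) l = ((k < n)%N)%:R.
Proof.
move=> tF Fkl.
have E (i : nat) : ind (F i) l = ((i == k)%N)%:R.
  rewrite /ind indicE; have [->|ik] := eqVneq i k; first by rewrite mem_set.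
  rewrite memNset// => Fil; move: ik => /eqP; apply.
  by apply: (tF i k) => //; exists l.
under eq_bigr do rewrite E.
elim: n => [|n IH]; first by rewrite big_ord0.
rewrite big_ord_recr/= IH -[(k < n.+1)%N]/(k <= n)%N [(k <= n)%N]leq_eqVlt [n == k]eq_sym.
case: eqVneq => [->|_]; first by rewrite ltnn add0r.
by rewrite addr0.
Qed.

(** Open right rays generate the Borel sets and are stable under intersection, so it suffices that
    the approximable indicators form a Dynkin class: complements by linearity, disjoint unions by
    bounded convergence. *)
Lemma appr_ind v (A : set R) : spectral_density v -> measurable A -> appr v (ind A).
Proof.
move=> wv mA.
have {}mA : (R.-ocitv.-measurable).-sigma.-measurable A by exact: mA.
rewrite RGenOInfty.measurableE in mA.
move: A mA; apply: (dynkin_induction (P := fun A => appr v (ind A))).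
- exact: RGenOInfty.measurableE.
- move=> _ _ [x ->] [y ->]; exists (Num.max x y).
  by apply/seteqP; split => l /=; rewrite !in_itv/= !andbT gt_max => /andP.
- rewrite (_ : ind setT = fun=> 1); first exact/appr_tpoly/tpoly_cst.
  by apply/funext => l; rewrite /ind indicT.
- by move=> _ [x ->]; exact: appr_ray.
- move=> S mS aS.
  have := apprD wv (cbd_cst 1) (cbdM (cbd_cst (-1)) (cbd_ind mS))
    (appr_tpoly _ (tpoly_cst 1)) (apprZ (-1) wv (cbd_ind mS) aS).
  congr appr; apply/funext => l; rewrite /ind !indicE in_setC.
  by case: (_ \in _) => /=; rewrite ?mulr1 ?subrr// mulr0 addr0.
- move=> F mF tF aF.
  have mU : measurable (\bigcup_k F k) by exact: bigcup_measurable.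
  (* Disjointness keeps every partial sum in {0, 1}; this is the uniform bound that [appr_lim]
     requires. *)
  have S01 n l : \sum_(i < n) ind (F i) l = 1 \/ \sum_(i < n) ind (F i) l = 0.
    have [[k _ Fk]|nF] := pselect ((\bigcup_k F k) l).
      by rewrite (sum_ind_trivIset n tF Fk); case: (k < n)%N; [left|right].
    right; rewrite big1// => i _; rewrite /ind indicE memNset// => Fil.
    by apply: nF; exists i.
  have bS n : cbd (fun l => \sum_(i < n) ind (F i) l).
    by apply: cbd_sum => i; apply: cbd_ind; exact: mF.
  apply: (@appr_lim _ _ (fun n l => \sum_(i < n) ind (F i) l) _ 1) => //.
  + exact: cmeasurable_ind.
  + by move=> n; case: (bS n).
  + by move=> l _; exact: nsq_ind_le.
  + by move=> n l _; case: (S01 n l) => ->; rewrite /nsq/= !expr0n ?expr1n ?addr0.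
  + elim=> [|n IH].
      under eq_fun do rewrite big_ord0; exact/appr_tpoly/tpoly_cst.
    under eq_fun do rewrite big_ord_recr/=.
    exact: (apprD wv (bS n) (cbd_ind (mF n)) IH (aF n)).
  + apply: aecW => l _; have [[k _ Fk]|nF] := pselect ((\bigcup_k F k) l).
      apply: cvg_near_cst; exists k.+1 => // n /= kn.
      rewrite (sum_ind_trivIset n tF Fk) kn /ind indicE mem_set; last by exists k.
      by rewrite subrr /nsq/= expr0n addr0.
    apply: cvg_near_cst; apply: nearW => n.
    rewrite big1 => [|i _]; first by rewrite /ind indicE memNset// subrr /nsq/= expr0n addr0.
    by rewrite /ind indicE memNset// => Fil; apply: nF; exists i.
Qed.

(* The first binary digit of [F] is an indicator; the remainder, doubled, is
   again a function with values in [0, 1]. *)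
Lemma dyadic_appr v n F : spectral_density v -> meas F ->
  (forall l, circle l -> 0 <= F l <= 1) ->
  exists2 k : R -> R[i], cbd k /\ appr v k &
    forall l, circle l -> nsq ((F l)%:C - k l) <= 4^-1 ^+ n.
Proof.
move=> wv; elim: n F => [|n IH] F mF F01.
  exists (fun=> 0); first by split; [exact: cbd_cst|exact/appr_tpoly/tpoly_cst].
  move=> l cl; rewrite subr0 nsq_real expr0; have /andP[a b] := F01 l cl.
  by rewrite expr_le1.
pose A := circle `&` F @^-1` `[2^-1, +oo[.
have mA : measurable A by apply: mF => //; exact: measurable_itv.
have AE l : circle l -> (l \in A) = (2^-1 <= F l).
  move=> cl; apply/idP/idP.
    by move=> /set_mem[_]/=; rewrite in_itv/= andbT.
  by move=> h; apply/mem_set; split => //=; rewrite in_itv/= andbT.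
have [||k [bk ak] hk] := IH (fun l => 2 * F l - \1_A l).
- apply: measurable_funB; last exact: measurable_indic.
  by apply: measurable_funM => //; exact: measurable_cst.
- move=> l cl; rewrite indicE AE//; have /andP[a b] := F01 l cl.
  by case: (leP 2^-1 (F l)) => c /=; apply/andP; split; lra.
exists (fun l => (2^-1)%:C * (ind A l + k l)).
  split.
    by apply: cbdM; [exact: cbd_cst|apply: cbdD => //; exact: cbd_ind].
  by apply: apprZ => //; [apply: cbdD => //|apply: apprD => //; [|exact: appr_ind]];
    exact: cbd_ind.
move=> l cl; rewrite (_ : _ - _ = (2^-1)%:C * ((2 * F l - \1_A l)%:C - k l)).
  by rewrite nsqM nsq_real [leRHS]exprS ler_pM ?nsq_ge0 ?sqr_ge0 ?hk//; lra.
by apply: complex_ext; rewrite /ind !cE/=; field.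
Qed.

Lemma appr_unit v F : spectral_density v -> meas F ->
  (forall l, circle l -> 0 <= F l <= 1) -> appr v (fun l => (F l)%:C).
Proof.
move=> wv mF F01; have [v0 iv] := wv.
have bF : cbd (fun l => (F l)%:C).
  apply: (@cbd_real _ _ 1) => // l cl; have /andP[a b] := F01 l cl.
  by rewrite ger0_norm.
have rv : 0 <= rmean v by exact: rmean_ge0.
apply: appr_closed => // e e0.
have c : (4^-1 : R) ^+ n @[n --> \oo] --> (0 : R).
  by apply: cvg_expr; rewrite ger0_norm; lra.
have d0 : 0 < e / (rmean v + 1) by rewrite divr_gt0//; lra.
move/cvgr0Pnorm_lt : c => /(_ _ d0)[n _ /(_ n (leqnn n)) /=].
rewrite ger0_norm ?exprn_ge0// => dn.
have [k [bk ak] hk] := dyadic_appr n wv mF F01.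
exists k; split => //.
apply: (@le_lt_trans _ _ (4^-1 ^+ n * rmean v)).
  rewrite -rmeanZ//; apply: rmean_le.
  - by have [] := cbd_l2 wv (cbdB bF bk).
  - exact: itgZ.
  - by apply: aecW => l cl; rewrite ler_wpM2r ?v0 ?hk.
move: dn; rewrite ltr_pdivlMr; last by lra.
have : 0 <= 4^-1 ^+ n :> R by exact: exprn_ge0.
nra.
Qed.

Lemma appr_real v F M : spectral_density v -> meas F ->
  aec (fun l => `|F l| <= M) -> appr v (fun l => (F l)%:C).
Proof.
move=> wv mF FM; pose K := `|M| + 1.
have K0 : 0 < K by rewrite /K; have := normr_ge0 M; lra.
(* The affine map taking [-K, K] onto [0, 1], then clipped: [appr_unit] wants its bounds at every
   point of the circle, while [F] is bounded only almost everywhere. *)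
pose G l := Num.max 0 (Num.min 1 ((2 * K)^-1 * F l + 2^-1)).
have mG : meas G.
  apply: measurable_maxr; first exact: measurable_cst.
  apply: measurable_minr; first exact: measurable_cst.
  apply: measurable_funD; last exact: measurable_cst.
  by apply: measurable_funM => //; exact: measurable_cst.
have G01 l : circle l -> 0 <= G l <= 1.
  by move=> _; rewrite /G le_max lexx ge_max ler01 ge_min lexx.
have aG := appr_unit wv mG G01.
have bG : cbd (fun l => (G l)%:C).
  apply: (@cbd_real _ _ 1) => // l cl; have /andP[a b] := G01 l cl.
  by rewrite ger0_norm.
have bZ : cbd (fun l => (2 * K)%:C * (G l)%:C) by apply: cbdM => //; exact: cbd_cst.
apply: (@appr_ae _ _ (fun l => (2 * K)%:C * (G l)%:C + (- K)%:C)) => //.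
- by apply: cmeasurableD; [case: bZ|exact: cmeasurable_cst].
- apply: aecS FM => l _ FM; rewrite -rmorphM -rmorphD; congr (_ %:C).
  have : `|F l| <= K by rewrite /K; have := ler_norm M; lra.
  rewrite ler_norml => /andP[a b].
  have p : 0 < 2 * K by lra.
  have q1 : (2 * K)^-1 * F l <= 2^-1.
    by rewrite mulrC ler_pdivrMr//; lra.
  have q2 : - 2^-1 <= (2 * K)^-1 * F l.
    by rewrite mulrC ler_pdivlMr//; lra.
  rewrite /G min_r; last by lra.
  rewrite max_r; last by lra.
  by field; rewrite gt_eqF.
- apply: apprD => //; first exact: cbd_cst.
    exact: apprZ.
  exact/appr_tpoly/tpoly_cst.
Qed.

Lemma appr_cbd v (h : R -> R[i]) : spectral_density v -> cbd h -> appr v h.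
Proof.
move=> wv bh; have [[mR mI] [M hM]] := bh.
have [[KR bR] [KI bI]] := (conj (cbd_Re bh) (cbd_Im bh)).
have cR : cbd (fun l => (complex.Re (h l))%:C).
  split; first exact: cmeasurable_real.
  exists M; apply: aecS hM => l _; apply: le_trans.
  by rewrite nsq_real /nsq lerDl sqr_ge0.
have cI : cbd (fun l => (complex.Im (h l))%:C).
  split; first exact: cmeasurable_real.
  exists M; apply: aecS hM => l _; apply: le_trans.
  by rewrite nsq_real /nsq lerDr sqr_ge0.
have := apprD wv cR (cbdM (cbd_cst 'i) cI) (appr_real wv mR bR)
  (apprZ 'i wv cI (appr_real wv mI bI)).
by congr appr; apply/funext => l; rewrite [RHS]complexE.
Qed.

End Density.

(** * Removing the Fourier coefficients with index 0..N *)

Section OuterClosure.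
Context {R : realType}.
Implicit Types (h k p : R -> R[i]) (v w F : R -> R) (N : nat).

(** The lists in [outer_span] may repeat an index, while coefficients depend on the index alone.
    Multiplicities absorb the repetitions, so that two combinations can be rewritten over one
    duplicate-free list. *)
Lemma sum_count_mem (I : eqType) (s s1 : seq I) (F : I -> R[i]) :
  uniq s -> {subset s1 <= s} ->
  \sum_(j <- s) (count_mem j s1)%:R * F j = \sum_(j <- s1) F j.
Proof.
move=> us; elim: s1 => [|x s1 IH] sub.
  by rewrite big_nil big1// => j _; rewrite mul0r.
rewrite big_cons -IH; last by move=> j js; apply: sub; rewrite inE js orbT.
under eq_bigr do rewrite /= natrD mulrDl.
rewrite big_split/=; congr (_ + _).
rewrite (bigD1_seq x)//=; last by apply: sub; rewrite inE eqxx.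
rewrite eqxx mul1r big1 ?addr0// => j jx.
by rewrite eq_sym (negbTE jx) mul0r.
Qed.

Lemma outer_span0 N : outer_span N (fun=> 0 : R[i]).
Proof.
exists [::], (fun=> 0); split => //.
by apply/funext => l; rewrite big_nil.
Qed.

Lemma outer_span_cexp N (j : int) : (j < 0) || (N%:Z < j) ->
  outer_span N (@cexp R j).
Proof.
move=> jo; exists [:: j], (fun=> 1); split; first by rewrite /= jo.
by apply/funext => l; rewrite big_seq1 mul1r.
Qed.

Lemma outer_spanZ N (c : R[i]) p : outer_span N p ->
  outer_span N (fun l => c * p l).
Proof.
move=> [s [d [os ->]]]; exists s, (fun j => c * d j); split => //.
by apply/funext => l; rewrite mulr_sumr; apply: eq_bigr => j _; rewrite mulrA.
Qed.

Lemma outer_spanD N p q : outer_span N p -> outer_span N q ->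
  outer_span N (fun l => p l + q l).
Proof.
move=> [s [c [os ->]]] [t [d [ot ->]]].
exists (undup (s ++ t)),
  (fun j => (count_mem j s)%:R * c j + (count_mem j t)%:R * d j); split.
  apply/allP => j; rewrite mem_undup mem_cat.
  by case/orP => ij; [exact: (allP os)|exact: (allP ot)].
apply/funext => l.
rewrite -(@sum_count_mem _ (undup (s ++ t)) s) ?undup_uniq//; last first.
  by move=> j js; rewrite mem_undup mem_cat js.
rewrite -(@sum_count_mem _ (undup (s ++ t)) t) ?undup_uniq//; last first.
  by move=> j js; rewrite mem_undup mem_cat js orbT.
by rewrite -big_split/=; apply: eq_bigr => j _; rewrite mulrDl !mulrA.
Qed.

Lemma outer_span_tpoly N p : outer_span N p -> tpoly p.
Proof.
move=> [s [c [_ ->]]]; elim: s => [|j s IH].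
  by under eq_fun do rewrite big_nil; exact: tpoly_cst.
under eq_fun do rewrite big_cons.
by apply: tpolyD => //; apply: tpolyZ; exact: tpoly_cexp.
Qed.

Definition fcoef h (k : nat) : R[i] := cmean (fun l => h l * cexp (- k%:Z) l).

Lemma cbd_shift h (j : int) : cbd h -> cbd (fun l => h l * cexp j l).
Proof. by move=> bh; apply: cbdM => //; exact: cbd_cexp. Qed.

Lemma tpoly_outer N p : tpoly p ->
  outer_span N (fun l => p l - \sum_(k < N.+1) fcoef p k * cexp k%:Z l).
Proof.
elim=> [j|p1 p2 t1 IH1 t2 IH2|c p1 t1 IH].
- have E (k : nat) : fcoef (cexp j) k = (j == k%:Z)%:R.
    rewrite /fcoef; under eq_fun do rewrite -cexpD.
    by rewrite cmean_cexp subr_eq0.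
  case: (boolP ((j < 0) || (N%:Z < j))) => jo.
    have := outer_span_cexp jo; congr outer_span; apply/funext => l.
    rewrite big1 ?subr0// => k _; rewrite E.
    case: eqP => [jk|_]; last by rewrite mul0r.
    move: jo; rewrite jk ltz_nat; case/orP => //.
    by rewrite ltnNge -ltnS ltn_ord.
  move: jo; rewrite negb_or -!leNgt => /andP[]; case: j E => // j E _.
  rewrite lez_nat -ltnS => jN.
  have := outer_span0 N; congr outer_span; apply/funext => l.
  rewrite (bigD1 (Ordinal jN))//= big1 ?addr0.
    by rewrite E eqxx mul1r subrr.
  move=> k kj; rewrite E; case: eqP => [[jk]|_]; last by rewrite mul0r.
  by case/negP: kj; apply/eqP/val_inj; rewrite /= jk.
- have := outer_spanD IH1 IH2; congr outer_span; apply/funext => l.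
  rewrite addrACA -opprD -big_split/=; congr (_ - _); apply: eq_bigr => k _.
  rewrite -mulrDl; congr (_ * _); rewrite /fcoef -cmeanD.
  + by congr cmean; apply/funext => x; rewrite mulrDl.
  + by apply: cbd_citg; apply: cbd_shift; exact: tpoly_cbd.
  + by apply: cbd_citg; apply: cbd_shift; exact: tpoly_cbd.
- have := outer_spanZ c IH; congr outer_span; apply/funext => l.
  rewrite mulrBr mulr_sumr; congr (_ - _); apply: eq_bigr => k _.
  rewrite mulrA; congr (_ * _); rewrite /fcoef -cmeanZ.
  + by congr cmean; apply/funext => x; rewrite mulrA.
  + by apply: cbd_citg; apply: cbd_shift; exact: tpoly_cbd.
Qed.

Lemma nsq_sum_le (n : nat) (z : 'I_n -> R[i]) (d : R) : 0 <= d ->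
  (forall i, nsq (z i) <= d) -> nsq (\sum_i z i) <= 4 ^+ n * d.
Proof.
move=> d0; elim: n z => [|n IH] z zd.
  by rewrite big_ord0 nsq_real expr0n mul1r.
rewrite big_ord_recr/=; apply: le_trans (nsqD_le _ _) _.
have := IH _ (fun i => zd (widen_ord (leqnSn n) i)); have := zd ord_max.
have : 1 <= 4 ^+ n :> R by rewrite exprn_ege1//; lra.
rewrite exprS; nra.
Qed.

Lemma sqmean_le1 w v h : spectral_density w -> spectral_density v ->
  (forall l, circle l -> w l <= v l) -> cbd h -> sqmean w h <= sqmean v h.
Proof.
move=> ww wv wlev bh; apply: rmean_le.
- by have [] := cbd_l2 ww bh.
- by have [] := cbd_l2 wv bh.
- by apply: aecW => l cl; rewrite ler_wpM2l ?nsq_ge0 ?wlev.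
Qed.

(* Approximating in the weight [w + 1] controls the Fourier coefficients of the
   approximant as well, so that those with index in 0..N can be removed. *)
Lemma cbd_L2N N w h : spectral_density w -> cbd h ->
  (forall k : nat, (k < N.+1)%N -> fcoef h k = 0) -> L2N N w h.
Proof.
move=> ww bh h0; split; first by apply/L2_l2 => //; exact: cbd_l2.
move=> e e0; have [w0 iw] := ww.
have w1 : spectral_density (fun=> 1 : R) by split => //; exact: itg_cst.
have wv : spectral_density (fun l => w l + 1).
  split => [l cl|]; first by rewrite addr_ge0 ?w0.
  by apply: itgD => //; exact: itg_cst.
have r0 : 0 <= rmean w by exact: rmean_ge0.
set K : R := 4 ^+ N.+1 * rmean w.
have K0 : 0 <= K by rewrite mulr_ge0// exprn_ge0.
(* The final error is at most 2 d + 2 K d; the extra 1 makes it strictly less than [e]. *)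
pose d := e / (2 + 2 * K + 1).
have d0 : 0 < d by rewrite divr_gt0//; lra.
have [p tp hp] := appr_cbd wv bh d0; have bp := tpoly_cbd tp.
pose u l := h l - p l; have bu : cbd u by exact: cbdB.
pose S l := \sum_(k < N.+1) fcoef p k * cexp k%:Z l.
have bS : cbd S by apply: cbd_sum => k; apply: cbdM; [exact: cbd_cst|exact: cbd_cexp].
exists (fun l => p l - S l); first exact: tpoly_outer.
have Sd l : nsq (S l) <= 4 ^+ N.+1 * d.
  apply: nsq_sum_le => [|k]; first exact: ltW.
  rewrite nsqM nsq_cexp mulr1.
  have -> : fcoef p k = -1 * fcoef u k.
    have : fcoef h k = fcoef p k + fcoef u k.
      rewrite /fcoef -cmeanD; [|apply: cbd_citg; exact: cbd_shift..].
      by congr cmean; apply/funext => x; rewrite -mulrDl addrC subrK.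
    by rewrite h0// mulN1r => /esym/eqP; rewrite addr_eq0 => /eqP.
  rewrite mulN1r nsqN; apply: le_trans (nsq_cmean_le (cbd_shift _ bu)) _.
  apply: le_trans (ltW hp).
  apply: (@le_trans _ _ (sqmean (fun=> 1) u)).
    rewrite le_eqVlt; apply/orP; left; apply/eqP; congr rmean.
    by apply/funext => x; rewrite nsqM nsq_cexp.
  by apply: sqmean_le1 => // x cx; rewrite lerDr w0.
have hq : sqmean w (fun l => h l - (p l - S l)) <= 2 * sqmean w u + 2 * sqmean w S.
  rewrite (_ : (fun _ => _) = fun l => u l + S l).
    by apply: sqmeanD_le => //; exact: cbd_l2.
  by apply/funext => l; rewrite /u; ring.
have uw : sqmean w u <= d.
  by apply: le_trans (ltW hp); apply: sqmean_le1 => // x cx; rewrite lerDl.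
have Sw : sqmean w S <= K * d.
  rewrite /K mulrAC -rmeanZ//; apply: rmean_le.
  - by have [] := cbd_l2 ww bS.
  - exact: itgZ.
  - by apply: aecW => l cl; rewrite ler_wpM2r ?w0.
rewrite sqnormE; last by apply: cbd_l2 => //; apply: cbdB => //; exact: cbdB.
rewrite lte_fin; apply: le_lt_trans hq _.
have : d * (2 + 2 * K + 1) = e by rewrite /d mulfVK// gt_eqF//; lra.
nra.
Qed.

End OuterClosure.

(** * Toeplitz matrices and the candidate h(f,g) *)

Section Projection.
Context {R : realType}.
Implicit Types (h : R -> R[i]) (f g w psi F : R -> R) (N : nat).
Local Notation mu := (@lebesgue_measure R).

Lemma meas_inv F : meas F -> (forall l, circle l -> 0 <= F l) ->
  meas (fun l => (F l)^-1).
Proof.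
move=> mF F0; apply: (@eq_measurable_fun _ _ _ _ circle (fun l => F l `^ (-1))).
  by move=> l /set_mem cl; rewrite powR_inv1// F0.
exact: (measurableT_comp (measurable_powR (-1)) mF).
Qed.

Lemma spectral_densityD f g : spectral_density f -> spectral_density g ->
  spectral_density (fun l => f l + g l).
Proof.
move=> [f0 fi] [g0 gi]; split => [l cl|]; first by rewrite addr_ge0 ?f0 ?g0.
exact: itgD.
Qed.

(** With 1/0 = +oo, a finite integral forces f + g > 0 almost everywhere; the real inverse, 0 at the
    zeros of f + g, is dominated by the extended one. *)
Lemma inv_integrableP f g : spectral_density f -> spectral_density g ->
  inv_integrable f g ->
  aec (fun l => 0 < f l + g l) /\ itg (fun l => (f l + g l)^-1).
Proof.
move=> hf hg; have [w0 iw] := spectral_densityD hf hg.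
set w := fun l => f l + g l in w0 iw *; have mw : meas w by exact: itg_meas.
rewrite /inv_integrable => foo.
have V0 l : circle l -> (0 <= ((w l)%:E)^-1)%E.
  by move=> cl; rewrite inve_ge0 lee_fin w0.
have VE l : (((w l)%:E)^-1 = if w l == 0%R then +oo else ((w l)^-1)%:E)%E by [].
have mV : measurable_fun circle (fun l => ((w l)%:E)^-1)%E.
  under eq_fun do rewrite VE.
  apply: measurable_fun_if => //.
  - exact: measurable_circle.
  - by apply: measurable_fun_eqr => //; exact: measurable_cst.
  - apply: (@measurable_funS _ _ _ _ circle) => //; first exact: measurable_circle.
    by apply/measurable_EFinP; exact: meas_inv.
have iV : mu.-integrable circle (fun l => ((w l)%:E)^-1)%E.
  apply/integrableP; split => //.
  rewrite (_ : (\int[mu]_(l in circle) `|((w l)%:E)^-1|)%E =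
     (\int[mu]_(l in circle) ((w l)%:E)^-1)%E)//.
  by apply: eq_integral => l /set_mem cl; rewrite gee0_abs// V0.
have wp : aec (fun l => 0 < w l).
  have : aec (fun l => ((w l)%:E)^-1%E \is a fin_num).
    by apply: (integrable_ae _ iV); exact: measurable_circle.
  apply: aecS => l cl; rewrite VE; case: eqP => // /eqP n0 _.
  by rewrite lt_neqAle eq_sym n0 w0.
split=> //; apply/integrableP; split.
  by apply/measurable_EFinP; exact: meas_inv.
have [mV' iVoo] := integrableP _ _ _ iV.
apply: le_lt_trans iVoo; apply: ge0_le_integral => //.
- exact: measurable_circle.
- by apply/measurable_EFinP; apply: measurableT_comp => //; exact: meas_inv.
- exact: measurableT_comp.
- by move=> l cl /=; rewrite VE; case: eqP => //=; rewrite leey.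
Qed.

Definition admissible f g := [/\ spectral_density f, spectral_density g,
  aec (fun l => 0 < f l + g l) & itg (fun l => (f l + g l)^-1)].

(** Expand |2s x + y|^2 >= 0 and |2s x - y|^2 >= 0 and divide by 4s. The free parameter does the
    work of Cauchy-Schwarz: for s = t (f + g) taken pointwise, the first term carries the weight and
    the second its inverse. *)
Lemma amgm (x y : R[i]) (s : R) : 0 < s ->
  `|complex.Re (x * conjc y)| <= s * nsq x + (4 * s)^-1 * nsq y.
Proof.
move=> s0; set k := (4 * s)^-1.
have k0 : 0 < k by rewrite invr_gt0; lra.
have ks : k * (4 * s) = 1 by rewrite mulVf// gt_eqF//; lra.
have p1 : 0 <= k * nsq ((2 * s)%:C * x + y) by rewrite mulr_ge0 ?nsq_ge0 ?ltW.
have p2 : 0 <= k * nsq ((2 * s)%:C * x - y) by rewrite mulr_ge0 ?nsq_ge0 ?ltW.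
have e1 : k * nsq ((2 * s)%:C * x + y) = (k * (4 * s)) * (s * nsq x) + k * nsq y
    + (k * (4 * s)) * complex.Re (x * conjc y).
  by rewrite /nsq !cE/=; ring.
have e2 : k * nsq ((2 * s)%:C * x - y) = (k * (4 * s)) * (s * nsq x) + k * nsq y
    - (k * (4 * s)) * complex.Re (x * conjc y).
  by rewrite /nsq !cE/=; ring.
rewrite e1 ks !mul1r in p1; rewrite e2 ks !mul1r in p2.
by rewrite ler_norml; apply/andP; split; lra.
Qed.

Lemma cbd_trig N (x : 'cV[R[i]]_N.+1) : cbd (trig x).
Proof.
apply: cbd_sum => j; apply: cbdM; [exact: cbd_cst|exact: cbd_cexp].
Qed.

Lemma citg_mul_real h psi : cbd h -> itg psi -> citg (fun l => h l * (psi l)%:C).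
Proof.
move=> bh ip; have [[mR mI] _] := bh.
have [[K hK] [L hL]] := (conj (cbd_Re bh) (cbd_Im bh)).
split.
- under eq_fun do rewrite ReM/= mulr0 subr0.
  exact: itg_mul_bounded hK ip.
- under eq_fun do rewrite ImM/= mulr0 add0r.
  exact: itg_mul_bounded hL ip.
Qed.

(** A Toeplitz matrix is the compression of multiplication by its symbol to the span of the
    exponentials 0..N. *)
Lemma toeplitz_mulE N psi (x : 'cV[R[i]]_N.+1) (k : 'I_N.+1) : itg psi ->
  (toeplitz N psi *m x) k 0 =
  cmean (fun l => trig x l * (psi l)%:C * cexp (- k%:Z) l).
Proof.
move=> ip; rewrite mxE.
rewrite (_ : (fun _ => _) = fun l => \sum_(j < N.+1)
    x j 0 * (cexp (- (k%:Z - j%:Z)) l * (psi l)%:C)); last first.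
  apply/funext => l; rewrite !mulr_suml; apply: eq_bigr => j _.
  rewrite opprB cexpD; ring.
have ij j : citg (fun l => cexp (- (k%:Z - j%:Z)) l * (psi l)%:C).
  by apply: citg_mul_real => //; exact: cbd_cexp.
rewrite cmean_sum => [|j _]; last exact: citgZ.
by apply: eq_bigr => j _; rewrite mxE cmeanZ// mulrC.
Qed.

Lemma inner_toeplitz N psi (x y : 'cV[R[i]]_N.+1) : itg psi ->
  inner (toeplitz N psi *m x) y =
  cmean (fun l => trig x l * (psi l)%:C * conjc (trig y l)).
Proof.
move=> ip; rewrite /inner.
have ik (k : 'I_N.+1) : citg (fun l => trig x l * (psi l)%:C * cexp (- k%:Z) l).
  under eq_fun do rewrite mulrAC.
  apply: citg_mul_real => //; apply: cbdM; [exact: cbd_trig|exact: cbd_cexp].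
under eq_bigr do rewrite toeplitz_mulE// mulrC -cmeanZ//.
rewrite -cmean_sum => [|k _]; last exact: citgZ.
congr cmean; apply/funext => l; rewrite conjc_sum mulr_sumr.
by apply: eq_bigr => k _; rewrite conjcM cexpN mulrCA.
Qed.

Lemma Re_inner_toeplitz N psi (x : 'cV[R[i]]_N.+1) : itg psi ->
  complex.Re (inner (toeplitz N psi *m x) x) =
  rmean (fun l => nsq (trig x l) * psi l).
Proof.
move=> ip; rewrite inner_toeplitz// cmeanE/=; congr rmean; apply/funext => l.
by rewrite /nsq !cE/=; ring.
Qed.

Lemma itg_nsq_trig N psi (x : 'cV[R[i]]_N.+1) : itg psi ->
  itg (fun l => nsq (trig x l) * psi l).
Proof.
move=> ip; have [m [M hM]] := cbd_trig x.
apply: (@itg_mul_bounded _ _ _ M) => //; first exact: meas_nsq.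
by apply: aecS hM => l _; rewrite ger0_norm ?nsq_ge0.
Qed.

Lemma trig_eq0 N (x : 'cV[R[i]]_N.+1) : aec (fun l => trig x l = 0) -> x = 0.
Proof.
move=> x0; apply/colP => k; rewrite mxE.
have : cmean (fun l => trig x l * cexp (- k%:Z) l) = x k 0.
  under eq_fun do rewrite mulr_suml.
  have E (j : 'I_N.+1) l : x j 0 * cexp j%:Z l * cexp (- k%:Z) l =
      x j 0 * cexp (j%:Z - k%:Z) l by rewrite cexpD mulrA.
  under eq_fun => l do under eq_bigr => j _ do rewrite E.
  rewrite cmean_sum => [|j _]; last by apply: citgZ; apply: cbd_citg; exact: cbd_cexp.
  rewrite (bigD1 k)//= big1 ?addr0.
    by rewrite cmeanZ ?cmean_cexp ?subrr ?eqxx ?mulr1//; apply: cbd_citg; exact: cbd_cexp.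
  move=> j jk; rewrite cmeanZ; last by apply: cbd_citg; exact: cbd_cexp.
  by rewrite cmean_cexp subr_eq0 eqz_nat (negbTE (_ : (j : nat) != k)) ?mulr0.
move=> <-; rewrite -cmean0 !cmeanE.
have [m1 m2] := (cbdM (cbd_trig x) (cbd_cexp (- k%:Z))).1.
by congr (_ +i* _); apply: rmean_ae => //; try exact: measurable_cst;
  apply: (aecS _ x0) => l _ ->; rewrite mul0r.
Qed.

(** For a kernel vector v the quadratic form, the mean of |trig v|^2 / (f + g), vanishes, hence so
    does trig v. The transposition passes to the left kernel, of which [inj_row_free] speaks. *)
Lemma matB_unit N f g : admissible f g -> matB N f g \in unitmx.
Proof.
move=> [hf hg wp iw]; have [w0 _] := spectral_densityD hf hg.
rewrite -unitmx_tr -row_free_unit; apply: inj_row_free => v.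
move=> /(congr1 trmx); rewrite trmx_mul trmxK trmx0 => Bv.
have /(congr1 (@complex.Re R)) : inner (matB N f g *m v^T) v^T = 0.
  by rewrite Bv /inner big1// => k _; rewrite mxE mul0r.
rewrite Re_inner_toeplitz//= => r0.
apply: trmx_inj; rewrite trmx0; apply: trig_eq0.
have : aec (fun l => nsq (trig v^T l) * (f l + g l)^-1 = 0).
  apply: rmean_eq0; [exact: itg_nsq_trig| |by rewrite r0].
  by move=> l cl; rewrite mulr_ge0 ?nsq_ge0// invr_ge0 w0.
apply: (aecS2 _ wp) => l _ wl /eqP.
rewrite mulf_eq0 invr_eq0 (gt_eqF wl) orbF => /eqP.
exact: nsq_eq0.
Qed.

(* The paper's h(f,g).  It may be unbounded, in which case only the vanishing of
   its Fourier coefficients 0..N is used, not membership in [L2N]. *)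
Definition hproj N (a : 'cV[R[i]]_N.+1) f g l : R[i] :=
  numer a f g l / (f l + g l)%:C.

Definition cvec N (a : 'cV[R[i]]_N.+1) f g : 'cV[R[i]]_N.+1 :=
  invmx (matB N f g) *m (matR N f g *m a).

Lemma hprojE N (a : 'cV[R[i]]_N.+1) f g l : hproj a f g l =
  trig a l * (f l / (f l + g l))%:C - trig (cvec a f g) l * ((f l + g l)^-1)%:C.
Proof.
rewrite /hproj /numer /CN -/(cvec a f g) -(fmorphV (real_complex R)) mulrBl.
by rewrite -mulrA -rmorphM.
Qed.

Lemma itg_ratio f g : spectral_density f -> spectral_density g ->
  itg (fun l => f l / (f l + g l)).
Proof.
move=> hf hg; have [w0 iw] := spectral_densityD hf hg.
have [[f0 fi] [g0 gi]] := (conj hf hg).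
apply: (itg_le _ (itg_cst 1)).
  apply: measurable_funM; first exact: itg_meas.
  by apply: meas_inv => //; exact: itg_meas.
apply: aecW => l cl; rewrite ger0_norm; last by rewrite divr_ge0 ?f0 ?w0.
have [->|wn] := eqVneq (f l + g l) 0; first by rewrite invr0 mulr0.
rewrite ler_pdivrMr; last by rewrite lt_neqAle eq_sym wn w0.
by rewrite mul1r lerDl g0.
Qed.

Lemma itg_harmonic f g : spectral_density f -> spectral_density g ->
  itg (fun l => f l * g l / (f l + g l)).
Proof.
move=> hf hg; have [w0 iw] := spectral_densityD hf hg.
have [[f0 fi] [g0 gi]] := (conj hf hg).
apply: (itg_le _ gi).
  apply: measurable_funM; first by apply: measurable_funM; exact: itg_meas.
  by apply: meas_inv => //; exact: itg_meas.
apply: aecW => l cl; rewrite ger0_norm; last by rewrite divr_ge0 ?mulr_ge0 ?f0 ?g0 ?w0.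
have [->|wn] := eqVneq (f l + g l) 0; first by rewrite invr0 mulr0 g0.
rewrite ler_pdivrMr; last by rewrite lt_neqAle eq_sym wn w0.
by have := f0 l cl; have := g0 l cl; nra.
Qed.

Lemma citg_hproj_shift N (a : 'cV[R[i]]_N.+1) f g (j : int) : admissible f g ->
  citg (fun l => hproj a f g l * cexp j l).
Proof.
move=> [hf hg wp iw].
rewrite (_ : (fun _ => _) = fun l =>
  trig a l * cexp j l * (f l / (f l + g l))%:C +
  -1 * (trig (cvec a f g) l * cexp j l * ((f l + g l)^-1)%:C)); last first.
  by apply/funext => l; rewrite hprojE; ring.
apply: citgD; last apply: citgZ; apply: citg_mul_real => //.
- by apply: cbdM; [exact: cbd_trig|exact: cbd_cexp].
- exact: itg_ratio.
- by apply: cbdM; [exact: cbd_trig|exact: cbd_cexp].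
Qed.

Lemma fcoef_hproj N (a : 'cV[R[i]]_N.+1) f g (k : nat) : admissible f g ->
  (k < N.+1)%N -> fcoef (hproj a f g) k = 0.
Proof.
move=> nd kN; have [hf hg wp iw] := nd.
have BR : matB N f g *m cvec a f g = matR N f g *m a.
  by rewrite /cvec mulKVmx// matB_unit.
have := congr1 (fun m : 'cV_N.+1 => m (Ordinal kN) 0) BR.
rewrite /= toeplitz_mulE// toeplitz_mulE; last exact: itg_ratio.
move=> /= E; rewrite /fcoef.
rewrite (_ : (fun _ => _) = fun l =>
  trig a l * (f l / (f l + g l))%:C * cexp (- k%:Z) l +
  -1 * (trig (cvec a f g) l * ((f l + g l)^-1)%:C * cexp (- k%:Z) l)); last first.
  by apply/funext => l; rewrite hprojE; ring.
have i1 (x : 'cV[R[i]]_N.+1) psi : itg psi ->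
    citg (fun l => trig x l * (psi l)%:C * cexp (- k%:Z) l).
  move=> ip; under eq_fun do rewrite mulrAC.
  by apply: citg_mul_real => //; apply: cbdM; [exact: cbd_trig|exact: cbd_cexp].
have ir := itg_ratio hf hg.
rewrite cmeanD ?cmeanZ; [|exact: i1|exact: i1|by apply: citgZ; exact: i1].
by rewrite -E mulN1r subrr.
Qed.

Lemma l2_hproj N (a : 'cV[R[i]]_N.+1) f g : admissible f g ->
  l2 (fun l => f l + g l) (hproj a f g).
Proof.
move=> [hf hg wp iw]; have [w0 sw] := spectral_densityD hf hg.
have [[f0 fi] [g0 gi]] := (conj hf hg).
have mh : cmeasurable (hproj a f g).
  rewrite (_ : hproj a f g = fun l => trig a l * (f l / (f l + g l))%:C -
     trig (cvec a f g) l * ((f l + g l)^-1)%:C); last first.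
    by apply/funext => l; rewrite hprojE.
  apply: cmeasurableB; apply: cmeasurableM.
  - by case: (cbd_trig a).
  - by apply: cmeasurable_real; apply: itg_meas; exact: itg_ratio.
  - by case: (cbd_trig (cvec a f g)).
  - by apply: cmeasurable_real; exact: itg_meas.
split => //.
(* With w = f + g: |h|^2 w <= 2 |A|^2 f^2 / w + 2 |C|^2 / w, and f^2 / w <= f. *)
apply: (itg_le _ (itgD (itgZ 2 (itg_nsq_trig a fi))
  (itgZ 2 (itg_nsq_trig (cvec a f g) iw)))).
  by apply: measurable_funM; [exact: meas_nsq|exact: itg_meas].
apply: (aecS _ wp) => l cl wl.
rewrite ger0_norm; last by rewrite mulr_ge0 ?nsq_ge0// ltW.
rewrite hprojE; apply: le_trans (ler_wpM2r (ltW wl) (nsqB_le _ _)) _.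
rewrite !nsqM !nsq_real mulrDl lerD//; last first.
  by rewrite le_eqVlt; apply/orP; left; apply/eqP; field; rewrite gt_eqF.
have -> : 2 * (nsq (trig a l) * (f l / (f l + g l)) ^+ 2) * (f l + g l) =
    2 * (nsq (trig a l) * f l) * (f l / (f l + g l)) by field; rewrite gt_eqF.
rewrite ler_piMr ?mulr_ge0 ?nsq_ge0 ?f0//.
by rewrite ler_pdivrMr// mul1r lerDl g0.
Qed.

End Projection.

(** * Orthogonality, completing the square, and the value of the objective *)

Section Optimality.
Context {R : realType}.
Implicit Types (h p : R -> R[i]) (f g w psi F : R -> R) (N : nat).
Local Notation mu := (@lebesgue_measure R).

(** No weight appears because this is the L2(f + g) inner product of h with trig x / (f + g); that
    quotient lies in L2(f + g) when 1/(f + g) is integrable, so the pairing is continuous there. *)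
Definition pairing N (x : 'cV[R[i]]_N.+1) h : R :=
  rmean (fun l => complex.Re (h l * conjc (trig x l))).

Lemma pairing_bound f g N (x : 'cV[R[i]]_N.+1) h (t : R) :
  admissible f g -> 0 < t -> l2 (fun l => f l + g l) h ->
  aec (fun l => `|complex.Re (h l * conjc (trig x l))| <=
    t * (nsq (h l) * (f l + g l)) +
    (4 * t)^-1 * (nsq (trig x l) * (f l + g l)^-1)).
Proof.
move=> [hf hg wp iw] t0 lh; apply: (aecS _ wp) => l _ wl.
apply: le_trans (amgm _ _ (mulr_gt0 t0 wl)) _.
rewrite le_eqVlt; apply/orP; left; apply/eqP; field.
by rewrite !gt_eqF.
Qed.

Lemma itg_pairing f g N (x : 'cV[R[i]]_N.+1) h :
  admissible f g -> l2 (fun l => f l + g l) h ->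
  itg (fun l => complex.Re (h l * conjc (trig x l))).
Proof.
move=> nd lh; have [hf hg wp iw] := nd.
apply: (itg_le _ _ (pairing_bound x nd ltr01 lh)).
  by have [] := cmeasurableM lh.1 (cmeasurable_conj (cbd_trig x).1).
by apply: itgD; apply: itgZ; [case: lh|exact: itg_nsq_trig].
Qed.

Lemma pairing_fcoef N (x : 'cV[R[i]]_N.+1) h :
  (forall k : 'I_N.+1, citg (fun l => h l * cexp (- k%:Z) l)) ->
  (forall k : 'I_N.+1, fcoef h k = 0) -> pairing x h = 0.
Proof.
move=> ih h0.
have -> : pairing x h = complex.Re (cmean (fun l => h l * conjc (trig x l))) by [].
rewrite (_ : (fun _ => _) = fun l =>
   \sum_(k < N.+1) conjc (x k 0) * (h l * cexp (- k%:Z) l)); last first.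
  apply/funext => l; rewrite conjc_sum mulr_sumr; apply: eq_bigr => k _.
  by rewrite conjcM cexpN mulrCA.
rewrite cmean_sum => [|k _]; last exact: citgZ.
rewrite big1// => k _; rewrite cmeanZ//.
by have := h0 k; rewrite /fcoef => ->; rewrite mulr0.
Qed.

Lemma pairing_hproj N (x a : 'cV[R[i]]_N.+1) f g : admissible f g ->
  pairing x (hproj a f g) = 0.
Proof.
move=> nd; apply: pairing_fcoef => k; first exact: citg_hproj_shift.
by apply: fcoef_hproj.
Qed.

Lemma fcoef_outer N p (k : 'I_N.+1) : outer_span N p -> fcoef p k = 0.
Proof.
move=> [s [c [os ->]]]; rewrite /fcoef.
rewrite (_ : (fun _ => _) = fun l => \sum_(j <- s) c j * cexp (j - k%:Z) l); last first.
  apply/funext => l; rewrite mulr_suml; apply: eq_bigr => j _.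
  by rewrite -mulrA cexpD.
rewrite cmean_sum => [|j _]; last by apply: citgZ; apply: cbd_citg; exact: cbd_cexp.
rewrite big_seq big1// => j js; rewrite cmeanZ; last by apply: cbd_citg; exact: cbd_cexp.
rewrite cmean_cexp subr_eq0; case: eqP => [jk|_]; last by rewrite mulr0.
have := allP os _ js; rewrite jk ltz_nat; case/orP => //.
by rewrite ltnNge -ltnS ltn_ord.
Qed.

Lemma pairing_outer N (x : 'cV[R[i]]_N.+1) p : outer_span N p -> pairing x p = 0.
Proof.
move=> op; apply: pairing_fcoef => k; last exact: fcoef_outer.
by apply: cbd_citg; apply: cbd_shift; apply: tpoly_cbd; exact: outer_span_tpoly op.
Qed.

Lemma pairing_L2N f g N (x : 'cV[R[i]]_N.+1) h : admissible f g ->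
  L2N N (fun l => f l + g l) h -> pairing x h = 0.
Proof.
move=> nd [L2h ah]; have [hf hg wp iw] := nd.
have sw := spectral_densityD hf hg.
have lh : l2 (fun l => f l + g l) h by apply/L2_l2.
pose K := rmean (fun l => nsq (trig x l) * (f l + g l)^-1).
have K0 : 0 <= K.
  by apply: rmean_ge0 => l cl; rewrite mulr_ge0 ?nsq_ge0// invr_ge0; have [->] := sw.
apply/eqP; rewrite -normr_le0; apply/ler_addgt0Pr => e e0; rewrite add0r.
(* This makes K / (4t) at most e/4, and the approximation error e / (2t) contributes at most e/2; K
   + 1 keeps [t] positive when K = 0. *)
pose t := (K + 1) / e.
have t0 : 0 < t by rewrite divr_gt0//; lra.
have [p op hp] := ah (e / (2 * t)) (divr_gt0 e0 (mulr_gt0 (ltr0n R 2) t0)).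
have lp : l2 (fun l => f l + g l) p.
  by apply: cbd_l2 => //; apply: tpoly_cbd; exact: outer_span_tpoly op.
have lu := l2B sw lh lp.
move: hp; rewrite sqnormE// lte_fin => hp.
have -> : pairing x h = pairing x (fun l => h l - p l).
  rewrite -[RHS]addr0 -(pairing_outer x op) -rmeanD; [|exact: itg_pairing nd _..].
  by congr rmean; apply/funext => l; rewrite !cE; ring.
have iu := itg_pairing x nd lu.
have B := pairing_bound x nd t0 lu.
have iB : itg (fun l => t * (nsq (h l - p l) * (f l + g l)) +
    (4 * t)^-1 * (nsq (trig x l) * (f l + g l)^-1)).
  by apply: itgD; apply: itgZ; [case: lu|exact: itg_nsq_trig].
have E : rmean (fun l => t * (nsq (h l - p l) * (f l + g l)) +
    (4 * t)^-1 * (nsq (trig x l) * (f l + g l)^-1)) =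
    t * sqmean (fun l => f l + g l) (fun l => h l - p l) + (4 * t)^-1 * K.
  have i1 : itg (fun l => nsq (h l - p l) * (f l + g l)) by case: lu.
  have i2 := itg_nsq_trig x iw.
  by rewrite rmeanD ?rmeanZ//; exact: itgZ.
have U : pairing x (fun l => h l - p l) <= t * sqmean (fun l => f l + g l) (fun l => h l - p l) + (4 * t)^-1 * K.
  rewrite -E; apply: rmean_le => //; apply: (aecS _ B) => l _.
  by apply: le_trans; exact: ler_norm.
have L : - pairing x (fun l => h l - p l) <= t * sqmean (fun l => f l + g l) (fun l => h l - p l) + (4 * t)^-1 * K.
  rewrite -E -mulN1r -rmeanZ//; apply: rmean_le => //; first exact: itgZ.
  apply: (aecS _ B) => l _; apply: le_trans; rewrite mulN1r.
  by rewrite -normrN ler_norm.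
have tn : t * sqmean (fun l => f l + g l) (fun l => h l - p l) <= e / 2.
  have := ltW hp; rewrite -(ler_pM2l t0); congr (_ <= _).
  by field; rewrite gt_eqF.
have tK : (4 * t)^-1 * K <= e / 4.
  rewrite /t mulrC -subr_ge0.
  have -> : e / 4 - K / (4 * ((K + 1) / e)) = (e / 4) * (K + 1)^-1.
    by field; rewrite !gt_eqF//; lra.
  by rewrite mulr_ge0// ?invr_ge0; lra.
by rewrite ler_norml; apply/andP; split; lra.
Qed.

(* The real-valued counterpart of [Delta]. *)
Definition err N (a : 'cV[R[i]]_N.+1) f g h : R :=
  sqmean f (fun l => trig a l - h l) + sqmean g h.

Lemma l2_le w v h : spectral_density w -> spectral_density v ->
  (forall l, circle l -> w l <= v l) -> l2 v h -> l2 w h.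
Proof.
move=> [w0 iw] [v0 iv] wv [mh ih]; split => //.
apply: (itg_le _ ih).
  by apply: measurable_funM; [exact: meas_nsq|exact: itg_meas].
apply: aecW => l cl; rewrite ger0_norm ?mulr_ge0 ?nsq_ge0 ?w0//.
by rewrite ler_wpM2l ?nsq_ge0 ?wv.
Qed.

Lemma l2_sum f g h : spectral_density f -> spectral_density g ->
  l2 (fun l => f l + g l) h -> l2 f h /\ l2 g h.
Proof.
move=> hf hg lh; have hw := spectral_densityD hf hg.
have [[f0 _] [g0 _]] := (conj hf hg).
by split; apply: l2_le lh => // l cl; rewrite ?lerDl ?lerDr ?f0 ?g0.
Qed.

Lemma l2_trigB f N (a : 'cV[R[i]]_N.+1) h : spectral_density f -> l2 f h ->
  l2 f (fun l => trig a l - h l).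
Proof. by move=> hf lh; apply: l2B => //; apply: cbd_l2 => //; exact: cbd_trig. Qed.

Lemma DeltaE N (a : 'cV[R[i]]_N.+1) f g h : spectral_density f ->
  spectral_density g -> l2 (fun l => f l + g l) h ->
  Delta a h f g = (err a f g h)%:E.
Proof.
move=> hf hg lh; have [lf lg] := l2_sum hf hg lh.
by rewrite /Delta !sqnormE//; exact: l2_trigB.
Qed.

Lemma CN_parts N (a : 'cV[R[i]]_N.+1) f g l : 0 < f l + g l ->
  CN a f g l = trig a l * (f l)%:C - hproj a f g l * (f l + g l)%:C.
Proof.
move=> w0; rewrite /hproj /numer divfK ?subKr//.
by rewrite -(rmorph0 (real_complex R)) (inj_eq (@complexI R)) gt_eqF.
Qed.

Lemma err_rmean N (a : 'cV[R[i]]_N.+1) f g h : spectral_density f ->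
  spectral_density g -> l2 (fun l => f l + g l) h ->
  itg (fun l => nsq (trig a l - h l) * f l + nsq (h l) * g l) /\
  err a f g h = rmean (fun l => nsq (trig a l - h l) * f l + nsq (h l) * g l).
Proof.
move=> hf hg lh; have [lf lg] := l2_sum hf hg lh.
have [_ i1] := l2_trigB a hf lf; have [_ i2] := lg.
by split; [exact: itgD|rewrite rmeanD].
Qed.

(** Orthogonality to C is assumed instead of membership in [L2N], so that the identity also applies
    directly to the candidate of another density, through [pairing_hproj]. *)
Lemma err_decomp N (a : 'cV[R[i]]_N.+1) f g h : admissible f g ->
  l2 (fun l => f l + g l) h -> pairing (cvec a f g) h = 0 ->
  err a f g h = err a f g (hproj a f g) +
    sqmean (fun l => f l + g l) (fun l => h l - hproj a f g l).
Proof.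
move=> nd lh h0; have [hf hg wp iw] := nd.
have hw := spectral_densityD hf hg.
have lH := l2_hproj a nd.
have H0 := pairing_hproj (cvec a f g) a nd.
have [ih ->] := err_rmean a hf hg lh; have [iH ->] := err_rmean a hf hg lH.
have [_ id] := l2B hw lh lH.
have ph := itg_pairing (cvec a f g) nd lh.
have pH := itg_pairing (cvec a f g) nd lH.
(* The cross term, -2 times a difference of two vanishing pairings, is added on the right. Both
   sides are then means of functions equal wherever f + g > 0, by C = A f - H (f + g). *)
rewrite -rmeanD// -[RHS]addr0 -(mulr0 (-2)) -[in X in _ + _ * X](subrr 0).
rewrite -{1}h0 -H0 -rmeanB// -rmeanZ; last exact: itgB.
rewrite -rmeanD; last first.
- by apply: itgZ; exact: itgB.
- exact: itgD.
apply: rmean_ae.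
- exact: itg_meas.
- by apply: itg_meas; apply: itgD; [exact: itgD|apply: itgZ; exact: itgB].
apply: (aecS _ wp) => l _ wl.
have := CN_parts a wl; rewrite /CN -/(cvec a f g) => ->.
by rewrite /nsq !cE/=; ring.
Qed.

(** By B c = R a the two inner products are the means of |C|^2 / (f + g) and |A|^2 f g / (f + g);
    their sum matches the error integrand pointwise once C = A f - H (f + g) is substituted. *)
Lemma objectiveE N (a : 'cV[R[i]]_N.+1) f g : admissible f g ->
  objective a f g = err a f g (hproj a f g).
Proof.
move=> nd; have [hf hg wp iw] := nd.
have [iH ->] := err_rmean a hf hg (l2_hproj a nd).
have BR : matR N f g *m a = matB N f g *m cvec a f g.
  by rewrite /cvec mulKVmx// matB_unit.
rewrite /objective -/(cvec a f g) ReD {1}BR.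
rewrite !Re_inner_toeplitz//; last exact: itg_harmonic.
have i1 := itg_nsq_trig (cvec a f g) iw.
have i2 := itg_nsq_trig a (itg_harmonic hf hg).
rewrite -rmeanD//; apply: rmean_ae.
- by apply: itg_meas; exact: itgD.
- exact: itg_meas.
apply: (aecS _ wp) => l _ wl.
have -> : trig (cvec a f g) l = trig a l * (f l)%:C - hproj a f g l * (f l + g l)%:C.
  exact: CN_parts.
by rewrite /nsq !cE/=; field; rewrite gt_eqF.
Qed.

End Optimality.

(** * The saddle point inequality *)

Section SaddlePoint.
Context {R : realType}.
Implicit Types (h : R -> R[i]) (f g : R -> R) (N : nat).
Local Notation mu := (@lebesgue_measure R).

Lemma nsq_hproj N (a : 'cV[R[i]]_N.+1) f g l :
  nsq (hproj a f g l) = cabs (numer a f g l) ^+ 2 / (f l + g l) ^+ 2.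
Proof.
by rewrite /hproj -(fmorphV (real_complex R)) nsqM nsq_real cabsE exprVn.
Qed.

Lemma hproj_optimal N (a : 'cV[R[i]]_N.+1) f g : admissible f g ->
  L2N N (fun l => f l + g l) (hproj a f g) -> optimal_char a f g (hproj a f g).
Proof.
move=> nd LH; split => // h Lh; have [hf hg _ _] := nd.
have hw := spectral_densityD hf hg.
have lh : l2 (fun l => f l + g l) h by apply/L2_l2 => //; case: Lh.
rewrite !DeltaE//; last exact: l2_hproj.
rewrite lee_fin (err_decomp nd lh (pairing_L2N _ nd Lh)) lerDl.
exact: sqmean_ge0.
Qed.

Lemma power_class_rmean P g : power_class P g -> rmean g <= P.
Proof. by move=> [[_ ig]]; rewrite mean_rmean// lee_fin. Qed.

Lemma rmean_power_class P g : spectral_density g -> rmean g <= P ->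
  power_class P g.
Proof. by move=> hg gP; split => //; case: hg => _ ig; rewrite mean_rmean// lee_fin. Qed.

Lemma inv_integrable_pos f g (e : R) : spectral_density f -> spectral_density g ->
  0 < e -> (forall l, circle l -> e <= f l + g l) -> inv_integrable f g.
Proof.
move=> hf hg e0 we; have [w0 iw] := spectral_densityD hf hg.
pose V l := (f l + g l)^-1; have iV : itg V.
  apply: (itg_le _ (itg_cst e^-1)); first by apply: meas_inv => //; exact: itg_meas.
  apply: aecW => l cl; rewrite ger0_norm ?invr_ge0 ?w0//.
  by rewrite lef_pV2 ?we// posrE// (lt_le_trans e0)// we.
have E : (\int[mu]_(l in circle) ((f l + g l)%R%:E)^-1 =
    \int[mu]_(l in circle) (EFin \o V) l)%E.
  apply: eq_integral => l /set_mem cl.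
  by rewrite /= inver gt_eqF// (lt_le_trans e0)// we.
rewrite /inv_integrable E.
by have fn := itg_fin_num iV; rewrite -(fineK fn) ltry.
Qed.

(* If the power constraint is slack at [g0], adding the constant [e] to [g0]
   would raise the objective unless the spectral characteristic vanishes. *)
Lemma slack_hproj_eq0 N (a : 'cV[R[i]]_N.+1) f g0 (e : R) : 0 < e ->
  admissible f g0 -> admissible f (fun l => g0 l + e) ->
  objective a f (fun l => g0 l + e) <= objective a f g0 ->
  aec (fun l => hproj a f g0 l = 0).
Proof.
move=> e0 nd nd1; rewrite !objectiveE//.
set H0 := hproj a f g0; set H1 := hproj a f (fun l => g0 l + e).
have [hf hg wp iw] := nd; have [_ hg1 _ _] := nd1.
have hw := spectral_densityD hf hg; have hw1 := spectral_densityD hf hg1.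
have he : spectral_density (fun=> e) by split => [l _|]; [exact: ltW|exact: itg_cst].
have l1 : l2 (fun l => f l + (g0 l + e)) H1 by exact: l2_hproj.
have l10 : l2 (fun l => f l + g0 l) H1.
  by apply: l2_le l1 => // l cl; rewrite lerD2l lerDl ltW.
have l1g : l2 g0 H1 by case: (l2_sum hf hg l10).
have l1e : l2 (fun=> e) H1.
  by case: (l2_sum hf hg1 l1) => _; apply: l2_le => // l cl; rewrite lerDr; have [->] := hg.
have l00 : l2 (fun l => f l + g0 l) H0 by exact: l2_hproj.
have -> : err a f (fun l => g0 l + e) H1 = err a f g0 H1 + sqmean (fun=> e) H1.
  rewrite /err -addrA; congr (_ + _); rewrite -rmeanD; [|by case: l1g|by case: l1e].
  by congr rmean; apply/funext => l; rewrite mulrDr.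
(* H1 serves as a competitor at [g0]: the objective at g0 + e exceeds the one at [g0] by the means
   of |H1 - H0|^2 (f + g0) and e |H1|^2. Optimality makes both vanish; the second gives H1 = 0, then
   the first H0 = 0. *)
rewrite (err_decomp nd l10 (pairing_hproj _ _ nd1)) -/H0 -addrA gerDl => le0.
have n1 := sqmean_ge0 H1 he.
have n2 := sqmean_ge0 (fun l => H1 l - H0 l) hw.
have z1 : aec (fun l => nsq (H1 l) * e = 0).
  apply: rmean_eq0; first by case: l1e.
  - by move=> l _; rewrite mulr_ge0 ?nsq_ge0 ?ltW.
  - by rewrite -/(sqmean (fun=> e) H1); lra.
have z2 : aec (fun l => nsq (H1 l - H0 l) * (f l + g0 l) = 0).
  apply: rmean_eq0; first by case: (l2B hw l10 l00).
  - by move=> l cl; rewrite mulr_ge0 ?nsq_ge0//; have [->] := hw.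
  - by rewrite -/(sqmean (fun l => f l + g0 l) (fun l => H1 l - H0 l)); lra.
have z3 := aecS2 (fun l _ a b => conj a b) z1 z2.
apply: (aecS2 _ wp z3) => l _ wl [/eqP].
rewrite mulf_eq0 (gt_eqF e0) orbF => /eqP/nsq_eq0 -> /eqP.
by rewrite mulf_eq0 (gt_eqF wl) orbF sub0r nsqN => /eqP/nsq_eq0.
Qed.

(** The terms weighted by f are common to both sides, so the claim compares the means of |H|^2 g and
    |H|^2 g0. *)
Lemma saddle_point N (a : 'cV[R[i]]_N.+1) (P alpha : R) f g0 g :
  0 < alpha -> power_class P g0 -> admissible f g0 -> cbd (hproj a f g0) ->
  aec (fun l => g0 l = Num.max 0 (alpha^-1 * cabs (numer a f g0 l) - f l)) ->
  (forall g, power_class P g -> inv_integrable f g ->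
     objective a f g <= objective a f g0) ->
  power_class P g ->
  err a f g (hproj a f g0) <= err a f g0 (hproj a f g0).
Proof.
move=> al0 P0 nd bH g0E opt Pg; have [hf hg0 wp iw] := nd; have [hg _] := Pg.
rewrite lerD2l; set H := hproj a f g0 in bH *.
have [_ iH0] := cbd_l2 hg0 bH; have [_ iH] := cbd_l2 hg bH.
have [[g0_ ig0] [g_ ig]] := (conj hg0 hg).
have [f0 _] := hf.
have cases : aec (fun l => nsq (H l) <= alpha ^+ 2 /\
    nsq (H l) * g0 l = alpha ^+ 2 * g0 l).
  apply: (aecS2 _ wp g0E) => l cl wl; rewrite nsq_hproj.
  have w2 : 0 < (f l + g0 l) ^+ 2 by rewrite exprn_gt0.
  set n := cabs _; have n0 : 0 <= n by exact: cabs_ge0.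
  have [c|c] := ltP 0 (alpha^-1 * n - f l).
    move=> ge.
    have -> : n = alpha * (f l + g0 l).
      by rewrite ge addrC subrK mulVKf// gt_eqF.
    by rewrite exprMn mulfK ?gt_eqF.
  (* Where the maximum is 0, the denominator is f alone and the numerator is at most alpha f. *)
  move=> ge; rewrite ge !mulr0; split=> //.
  move: w2; rewrite ge addr0 => w2; rewrite ler_pdivrMr// -exprMn.
  rewrite lerXn2r ?nnegrE ?mulr_ge0 ?f0 ?(ltW al0)//.
  by move: c; rewrite subr_le0 ler_pdivrMl.
have nv0 : sqmean g0 H = alpha ^+ 2 * rmean g0.
  rewrite -rmeanZ//; apply: rmean_ae; [exact: itg_meas..| |].
    by apply: itg_meas; exact: itgZ.
  by apply: aecS cases => l _ [].
have nvg : sqmean g H <= alpha ^+ 2 * rmean g.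
  rewrite -rmeanZ//; apply: rmean_le => //; first exact: itgZ.
  by apply: aecS cases => l cl [le _]; rewrite ler_wpM2r ?g_.
have gP := power_class_rmean Pg.
have a2 : 0 <= alpha ^+ 2 by exact: sqr_ge0.
have [Pg0|g0P] := leP P (rmean g0).
  rewrite nv0; apply: (le_trans nvg); rewrite ler_wpM2l//.
  exact: le_trans Pg0.
pose e := P - rmean g0; have e0 : 0 < e by rewrite subr_gt0.
have hg1 : spectral_density (fun l => g0 l + e).
  split => [l cl|]; first by rewrite addr_ge0 ?g0_ ?ltW.
  by apply: itgD => //; exact: itg_cst.
have P1 : power_class P (fun l => g0 l + e).
  apply: rmean_power_class => //; rewrite rmeanD ?rmean_cst//; last exact: itg_cst.
  by rewrite /e addrC subrK.
have inv1 : inv_integrable f (fun l => g0 l + e).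
  apply: (inv_integrable_pos hf hg1 e0) => l cl.
  by rewrite addrA lerDr addr_ge0 ?f0 ?g0_.
have [wp1 iw1] := inv_integrableP hf hg1 inv1.
have H0 : aec (fun l => H l = 0).
  by apply: (@slack_hproj_eq0 _ _ _ _ e) => //; exact: opt.
have -> : sqmean g H = sqmean g (fun=> 0).
  by apply: sqmean_ae H0; [exact: itg_meas|case: bH|exact: cmeasurable_cst].
have -> : sqmean g (fun=> 0) = 0.
  rewrite /sqmean -[RHS](rmean_cst 0); congr rmean; apply/funext => l.
  by rewrite nsq_real expr0n mul0r.
exact: sqmean_ge0.
Qed.

End SaddlePoint.

Theorem theorem7p3 (R : realType) (N : nat) (a : 'cV[R[i]]_N.+1) (P2 : R)
    (hP2 : 0 < P2) (f g0 : R -> R)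
    (hf : spectral_density f)
    (hg0 : power_class P2 g0)
    (hmin : inv_integrable f g0)
    (hbound : exists M : R, {ae @lebesgue_measure R, forall l, circle l ->
       cabs (numer a f g0 l) ^+ 2 / (f l + g0 l) ^+ 2 <= M})
    (alpha2 : R) (halpha2 : 0 < alpha2)
    (hg0E : {ae @lebesgue_measure R, forall l, circle l ->
       g0 l = Num.max 0 (alpha2^-1 * cabs (numer a f g0 l) - f l)})
    (hopt : is_max
       [set objective a f g | g in [set g | power_class P2 g /\ inv_integrable f g]]
       (objective a f g0)) :
  let h0 := fun l => numer a f g0 l / (f l + g0 l)%:C in
  least_favourable a f (power_class P2) g0 /\
  minimax_robust a f (power_class P2) h0.
Proof.
move=> h0; have [hg _] := hg0.
have [wp iw] := inv_integrableP hf hg hmin.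
have nd : admissible f g0 by [].
have bh : cbd h0.
  split; first by case: (l2_hproj a nd).
  have [M hM] := hbound; exists M; apply: (aecS _ hM) => l _.
  by rewrite -nsq_hproj.
have L2h g : spectral_density g -> L2N N (fun l => f l + g l) h0.
  move=> hg'; apply: cbd_L2N => //; first exact: spectral_densityD.
  by move=> k kN; exact: (fcoef_hproj a nd kN).
have opt0 : optimal_char a f g0 h0 by apply: hproj_optimal => //; exact: L2h.
have saddle g : power_class P2 g -> (Delta a h0 f g <= Delta a h0 f g0)%E.
  move=> Pg; have [hg' _] := Pg; rewrite !DeltaE ?lee_fin//.
  - apply: (saddle_point halpha2 hg0 nd bh hg0E _ Pg) => g' Pg' ig'.
    by apply: hopt.2; exists g'.
  - by apply: cbd_l2 => //; exact: spectral_densityD.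
  - by apply: cbd_l2 => //; exact: spectral_densityD.
split.
  split => //; exists h0 => //; split; first by exists g0, h0.
  (* h0 is a competitor at every [g], so Delta(h; f, g) <= Delta(h0; f, g) <= Delta(h0; f, g0) for
     any optimal h. *)
  move=> _ [g [h [Pg [_ opt] ->]]]; apply: le_trans (saddle _ Pg).
  by apply: opt; apply: L2h; case: Pg.
have HDh : HD N f (power_class P2) h0 by move=> g [hg' _]; exact: L2h.
split => //; split; first by exists h0.
(* Through the saddle value: the worst error of h0 is at most Delta(h0; f, g0) <= Delta(h; f, g0),
   hence at most the worst error of h. *)
move=> _ [h HDh' <-]; apply: (@le_trans _ _ (Delta a h0 f g0)).
  by apply: ub_ereal_sup => _ [g Pg <-]; exact: saddle.
apply: (@le_trans _ _ (Delta a h f g0)); first by apply: opt0.2; exact: HDh'.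
by apply: ereal_sup_ubound; exists g0.
Qed.
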